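(* Let $B=\left\{\begin{pmatrix} a&0\\ z&a^{-1}\end{pmatrix}\;\middle|\; a\in\mathbb{R}_{>0},\,z\in\mathbb{C}\right\}$, regarded as a real Lie group, and let $B_{\mathbb{R}}=\mathbb{R}\times B\times\mathbb{R}$ be the Lie groupoid over $\mathbb{R}$ with product $(x,g,y)(y,h,z)=(x,gh,z)$. Define on $B_{\mathbb{R}}$ the bivector $\Pi$ by $\Pi(x,g,y)=\Pi_{x,y}(g)$, where $\Pi_{x,y}$ is the following bivector on $B$ (using $T_gB\subseteq T_gM_2(\mathbb{C})\cong M_2(\mathbb{C})$, wedge products over $\mathbb{R}$): $$\Pi_{x,y}\!\left(\begin{pmatrix} a&0\\ z&a^{-1}\end{pmatrix}\right)=\begin{pmatrix}0&0\\ iz&0\end{pmatrix}\wedge\begin{pmatrix}-a&0\\0&a^{-1}\end{pmatrix}+\tfrac14\left(xa^2-ya^{-2}\right)\begin{pmatrix}0&0\\ i&0\end{pmatrix}\wedge\begin{pmatrix}0&0\\1&0\end{pmatrix}.$$ Then $\Pi$ is a Poisson bivector turning $B_{\mathbb{R}}$ into a Poisson groupoid, and its associated Lie bialgebroid is $\mathfrak{B}_{\mathbb{R}}$ with the Lie bialgebroid structure given by its duality with $\mathfrak{A}_{\mathbb{R}}$ (as described in the context).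
   Context: Groupoid conventions: $\mathscr{G}^{(2)}=\{(f,g)\in\mathscr{G}\times\mathscr{G}\mid t(f)=s(g)\}$. For $B_{\mathbb{R}}$, $s(x,g,y)=x$, $t(x,g,y)=y$, and the units are $(x,e_B,x)$. A Poisson groupoid is a Lie groupoid $\mathscr{G}$ with a Poisson structure such that $\{(f,g,h)\mid (f,g)\in\mathscr{G}^{(2)},\,h=fg\}$ is a coisotropic submanifold of $\mathscr{G}\times\mathscr{G}\times\overline{\mathscr{G}}$, where $\overline{\mathscr{G}}$ is $\mathscr{G}$ with the opposite Poisson structure. The Poisson bracket of $\Pi$ is $\{f,g\}=\Pi(df,dg)$, with $(V\wedge W)(df,dg)=V(f)W(g)-V(g)W(f)$. The Lie algebroid of a Lie groupoid is $A=\ker(ds)|_{\mathscr{O}}$ with anchor $\rho=dt|_A$; $\Gamma(A)$ is identified with left-invariant vector fields on $\mathscr{G}$ and $C^\infty(\mathscr{O})$ with $t^*C^\infty(\mathscr{O})$. Lie bialgebroids: a Lie bialgebroid is a Lie algebroid $A$ with a Lie algebroid structure (anchor $\rho_*$) on $A^*$ such that $\delta(X)(\xi,\eta)=\langle X,[\xi,\eta]\rangle-\rho_*(\xi)\langle X,\eta\rangle+\rho_*(\eta)\langle X,\xi\rangle$ satisfies $\delta([X,Y])=[\delta(X),Y]+[X,\delta(Y)]$ for the Gerstenhaber extension of the bracket to $\Gamma(\Lambda A)$, where $(X\wedge Y)(\xi,\eta)=\langle X,\xi\rangle\langle Y,\eta\rangle-\langle X,\eta\rangle\langle Y,\xi\rangle$.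 The Lie bialgebroid associated to a Poisson groupoid is the Lie algebroid $A$ with the operation $\delta$ determined by $$\delta(f)(dg)=\{g,f\},\qquad \delta(X)(df,dg)=\{Xf,g\}+\{f,Xg\}-X(\{f,g\}),$$ for $f\in t^*C^\infty(\mathscr{O})$ in the first formula and $X$ a left-invariant vector field in the second. The Lie algebra $\mathfrak{b}$ of $B$ has basis $\hat J_1,\hat J_2,\hat J_3$ with $$2\hat J_1=\begin{pmatrix}-1&0\\0&1\end{pmatrix},\quad 2\hat J_2=\begin{pmatrix}0&0\\ i&0\end{pmatrix},\quad 2\hat J_3=\begin{pmatrix}0&0\\1&0\end{pmatrix},$$ so $[\hat J_1,\hat J_2]=\hat J_2$, $[\hat J_1,\hat J_3]=\hat J_3$, $[\hat J_2,\hat J_3]=0$. The Lie algebroid $\mathfrak{B}_{\mathbb{R}}=\mathfrak{b}\oplus T\mathbb{R}$ over $\mathbb{R}$ is the direct sum Lie algebroid with anchor $(a,t)\mapsto t$; it is the Lie algebroid of $B_{\mathbb{R}}$. Its frame is $\hat J_i=(\hat J_i,0)$ ($i=1,2,3$), $\hat J_0=(0,2\frac{\partial}{\partial y})$. The Lie algebroid $\mathfrak{A}_{\mathbb{R}}$ is the bundle of Lie algebras over $\mathbb{R}$ (zero anchor) with frame $J_0,J_1,J_2,J_3$, where in the fibre over $y$: $J_0$ is central, $[J_1,J_2]=2J_3$, $[J_2,J_3]=2yJ_1+2J_0$, $[J_3,J_1]=2J_2$. The frames $(J_i)$ and $(\hat J_i)$ are declared dual, so $\mathfrak{A}_{\mathbb{R}}=\mathfrak{B}_{\mathbb{R}}^*$;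 the resulting Lie bialgebroid structure on $\mathfrak{B}_{\mathbb{R}}$ has the operation $\hat\delta$ which vanishes on $C^\infty(\mathbb{R})$ and satisfies $\hat\delta(X)(\xi,\eta)=\langle X,[\xi,\eta]\rangle$ for $X\in\Gamma(\mathfrak{B}_{\mathbb{R}})$ and $\xi,\eta\in\Gamma(\mathfrak{A}_{\mathbb{R}})$. *)

(* Defs.v *)
From HB Require Import structures.
From mathcomp Require Import all_boot all_order all_algebra.
From mathcomp Require Import all_classical all_reals all_analysis.
From mathcomp Require Import complex.

Set Implicit Arguments.
Unset Strict Implicit.
Unset Printing Implicit Defensive.

Import Order.TTheory GRing.Theory Num.Theory.
Import numFieldNormedType.Exports.

Local Open Scope classical_set_scope.
Local Open Scope ring_scope.

(* All partial derivatives of order at most [k] exist and are continuous at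
   the points of [U]. For [U] open this only depends on [f] on [U]. *)
Fixpoint Ck (R : realType) (n k : nat) (U : set 'rV[R]_n)
    (f : 'rV[R]_n -> R) : Prop :=
  (forall x, U x -> {for x, continuous f}) /\
  match k with
  | 0%N => True
  | k'.+1 => forall i : 'I_n,
      (forall x, U x -> derivable f x (delta_mx 0 i)) /\
      Ck k' U (fun x => 'D_(delta_mx 0 i) f x)
  end.

Definition Cinfty (R : realType) (n : nat) (U : set 'rV[R]_n)
    (f : 'rV[R]_n -> R) : Prop :=
  forall k, Ck k U f.

(* The chart [crd] identifies the type [pt] with an open subset of R^n; outside
   that subset its inverse [prm] takes irrelevant values. *)
Record manifold (R : realType) (n : nat) := Manifold {
  pt :> Type;
  crd : pt -> 'rV[R]_n;
  prm : 'rV[R]_n -> pt;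
  crdK : cancel crd prm;
  crd_open : open (range crd)
}.
Arguments crd {R n M} _ : rename.
Arguments prm {R n M} _ : rename.

Definition mopen (R : realType) n (M : manifold R n) (W : set M) : Prop :=
  open (crd @` W).

Definition smooth_in (R : realType) n (M : manifold R n) (W : set M)
    (f : M -> R) : Prop :=
  Cinfty (crd @` W) (f \o prm).

Definition smooth (R : realType) n (M : manifold R n) (f : M -> R) : Prop :=
  smooth_in setT f.

Definition smoothv_in (R : realType) n (M : manifold R n) k (W : set M)
    (F : M -> 'rV[R]_k) : Prop :=
  forall j, smooth_in W (fun p => F p 0 j).

Definition smoothv (R : realType) n (M : manifold R n) k
    (F : M -> 'rV[R]_k) : Prop :=
  smoothv_in setT F.

Definition smoothmx (R : realType) n (M : manifold R n) k l
    (F : M -> 'M[R]_(k, l)) : Prop :=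
  forall i j, smooth (fun p => F p i j).

Definition smooth_map (R : realType) n k (M : manifold R n)
    (N : manifold R k) (F : M -> N) : Prop :=
  smoothv (fun p => crd (F p)).

(* Smoothness along a subset: local existence of smooth extensions. *)
Definition smoothv_along (R : realType) n (M : manifold R n) k (C : set M)
    (F : M -> 'rV[R]_k) : Prop :=
  forall c, C c -> exists (W : set M) (H : M -> 'rV[R]_k),
    [/\ mopen W, W c, smoothv_in W H & forall p, C p -> W p -> H p = F p].

Definition pd (R : realType) n (M : manifold R n) (f : M -> R) (i : 'I_n)
    (p : M) : R :=
  'D_(delta_mx 0 i) (f \o prm) (crd p).

(* Tangent vectors and covectors at a point are row vectors of components in
   the chart; [vapp v f p] is the derivative of [f] along [v] at [p]. *)
Definition vapp (R : realType) n (M : manifold R n) (v : 'rV[R]_n)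
    (f : M -> R) (p : M) : R :=
  \sum_i v 0 i * pd f i p.

(* The differential of [F] at [p] is [v |-> v *m jac F p]. *)
Definition jacv (R : realType) n (M : manifold R n) k (F : M -> 'rV[R]_k)
    (p : M) : 'M[R]_(n, k) :=
  \matrix_(i, j) pd (fun q => F q 0 j) i p.

Definition jac (R : realType) n k (M : manifold R n) (N : manifold R k)
    (F : M -> N) (p : M) : 'M[R]_(n, k) :=
  jacv (fun q => crd (F q)) p.

Lemma line_crdK (R : realType) :
  cancel (fun t : R => \row_(_ < 1) t) (fun v : 'rV[R]_1 => v 0 0).
Proof. by move=> t; rewrite mxE. Qed.

Lemma line_crd_open (R : realType) :
  open (range (fun t : R => \row_(_ < 1) t)).
Proof.
rewrite (_ : range _ = setT); first exact: openT.
apply/seteqP; split=> // v _; exists (v 0 0) => //.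
by apply/rowP=> j; rewrite mxE (ord1 j).
Qed.

Definition line (R : realType) : manifold R 1 :=
  Manifold (@line_crdK R) (@line_crd_open R).

Lemma prod_crdK (R : realType) m n (M : manifold R m) (N : manifold R n) :
  cancel (fun p : M * N => row_mx (crd p.1) (crd p.2))
    (fun v => (prm (lsubmx v) : M, prm (rsubmx v) : N)).
Proof. by case=> p q /=; rewrite row_mxKl row_mxKr !crdK. Qed.

Lemma prod_crd_open (R : realType) m n (M : manifold R m)
    (N : manifold R n) :
  open (range (fun p : M * N => row_mx (crd p.1) (crd p.2))).
Proof.
have cmx k l (h : 'I_l -> 'I_k) :
    continuous (fun v : 'rV[R]_k => \row_j v 0 (h j)).
  move=> v A [e /= e0 eA].
  have ev i j : nbhs v [set w : 'rV[R]_k | e i j (w 0 (h j))].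
    have := e0 i j; rewrite mxE => eij.
    exact: (@coord_continuous R 1 k 0 (h j) v _ eij).
  have FF : Filter (nbhs v) by exact: nbhs_filter.
  have := filter_forall FF (fun i => filter_forall FF (ev i)).
  by apply: filterS => w ew; apply: eA => i j; rewrite mxE; exact: ew.
rewrite [X in open X](_ : _ =
  (fun v : 'rV[R]_(m + n) => \row_j v 0 (lshift n j)) @^-1` range (@crd R m M) `&`
  (fun v : 'rV[R]_(m + n) => \row_j v 0 (rshift m j)) @^-1` range (@crd R n N)).
  by apply: openI; apply: open_comp; try exact: crd_open;
    move=> v _; exact: cmx.
apply/seteqP; split=> [v [[p q] _ <-] /=|v /= [[p _ pv] [q _ qv]]].
  split; [exists p|exists q] => //; apply/rowP=> j; rewrite mxE.
    by rewrite row_mxEl.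
  by rewrite row_mxEr.
exists (p, q) => //=; rewrite pv qv -[RHS]hsubmxK.
by congr row_mx; apply/rowP=> j; rewrite !mxE.
Qed.

Definition mprod (R : realType) m n (M : manifold R m) (N : manifold R n) :
    manifold R (m + n) :=
  Manifold (@prod_crdK R m n M N) (@prod_crd_open R m n M N).

(* Embedded submanifolds of codimension k, as local regular level sets. *)
Definition submanifold (R : realType) n (M : manifold R n) (C : set M) :
    Prop :=
  exists k : nat, forall c, C c ->
  exists (W : set M) (F : M -> 'rV[R]_k),
    [/\ mopen W, W c, smoothv_in W F,
        forall p, W p -> (C p <-> F p = 0)
      & forall p, W p -> C p -> row_full (jacv F p)].

Definition velocity (R : realType) n (M : manifold R n) (c : line R -> M) :
    'rV[R]_n :=
  \row_j pd (fun t => crd (c t) 0 j) 0 (0 : line R).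

(* [c] is a curve, smooth near 0 and contained in [C] near 0, with
   [c 0 = p] and [c' 0 = v]. *)
Definition curve_in (R : realType) n (M : manifold R n) (C : set M)
    (c : line R -> M) (p : M) (v : 'rV[R]_n) : Prop :=
  [/\ exists W : set (line R),
        [/\ mopen W, W 0, smoothv_in W (fun t => crd (c t))
          & forall t, W t -> C (c t)],
      c 0 = p & velocity c = v].

Definition tangent (R : realType) n (M : manifold R n) (C : set M) (p : M)
    (v : 'rV[R]_n) : Prop :=
  exists c, curve_in C c p v.

(* A bivector at a point is the antisymmetric matrix [P i j = P(dx_i, dx_j)]. *)
Definition wedge (R : realType) n (v w : 'rV[R]_n) : 'M[R]_n :=
  v^T *m w - w^T *m v.

Definition bivapp (R : realType) n (M : manifold R n) (P : 'M[R]_n)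
    (f g : M -> R) (p : M) : R :=
  \sum_i \sum_j P i j * pd f i p * pd g j p.

Definition pbracket (R : realType) n (M : manifold R n) (P : M -> 'M[R]_n)
    (f g : M -> R) : M -> R :=
  fun p => bivapp (P p) f g p.

Definition poisson (R : realType) n (M : manifold R n) (P : M -> 'M[R]_n) :
    Prop :=
  [/\ smoothmx P, forall p, (P p)^T = - P p
    & forall f g h : M -> R, smooth f -> smooth g -> smooth h -> forall p,
        pbracket P f (pbracket P g h) p + pbracket P g (pbracket P h f) p
        + pbracket P h (pbracket P f g) p = 0].

(* P^#(N^*C) is contained in TC, where N^*C is the conormal bundle of C. *)
Definition coisotropic (R : realType) n (M : manifold R n)
    (P : M -> 'M[R]_n) (C : set M) : Prop :=
  submanifold C /\
  forall p, C p -> forall alpha : 'rV[R]_n,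
    (forall v, tangent C p v -> alpha *m v^T = 0) ->
    tangent C p (alpha *m P p).

(* [gmul f g] is relevant only if [gtgt f = gsrc g]. *)
Record groupoid_data (R : realType) n m (G : manifold R n)
    (M : manifold R m) := GroupoidData {
  gsrc : G -> M;
  gtgt : G -> M;
  gmul : G -> G -> G;
  gone : M -> G;
  ginv : G -> G
}.

Definition lie_groupoid (R : realType) n m (G : manifold R n)
    (M : manifold R m) (D : groupoid_data G M) : Prop :=
  [/\ [/\ forall f g, gtgt D f = gsrc D g -> gsrc D (gmul D f g) = gsrc D f,
          forall f g, gtgt D f = gsrc D g -> gtgt D (gmul D f g) = gtgt D g
        & forall f g h, gtgt D f = gsrc D g -> gtgt D g = gsrc D h ->
            gmul D f (gmul D g h) = gmul D (gmul D f g) h],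
      [/\ forall y, gsrc D (gone D y) = y,
          forall y, gtgt D (gone D y) = y,
          forall g, gmul D (gone D (gsrc D g)) g = g
        & forall g, gmul D g (gone D (gtgt D g)) = g],
      [/\ forall g, gsrc D (ginv D g) = gtgt D g,
          forall g, gtgt D (ginv D g) = gsrc D g,
          forall g, gmul D (ginv D g) g = gone D (gtgt D g)
        & forall g, gmul D g (ginv D g) = gone D (gsrc D g)],
      [/\ smooth_map (gsrc D), smooth_map (gtgt D), smooth_map (gone D),
          smooth_map (ginv D)
        & smoothv_along
            [set fg : mprod G G | gtgt D fg.1 = gsrc D fg.2]
            (fun fg : mprod G G => crd (gmul D fg.1 fg.2))]
    & forall g, row_full (jac (gsrc D) g) /\ row_full (jac (gtgt D) g)].

Definition mul_graph (R : realType) n m (G : manifold R n)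
    (M : manifold R m) (D : groupoid_data G M) :
    set (mprod (mprod G G) G) :=
  [set q | gtgt D q.1.1 = gsrc D q.1.2 /\ q.2 = gmul D q.1.1 q.1.2].

(* The product Poisson structure of G x G x (G with the opposite one). *)
Definition graph_bivector (R : realType) n (G : manifold R n)
    (P : G -> 'M[R]_n) (q : mprod (mprod G G) G) : 'M[R]_(n + n + n) :=
  block_mx (block_mx (P q.1.1) 0 0 (P q.1.2)) 0 0 (- P q.2).

Definition poisson_groupoid (R : realType) n m (G : manifold R n)
    (M : manifold R m) (D : groupoid_data G M) (P : G -> 'M[R]_n) : Prop :=
  [/\ lie_groupoid D, poisson P
    & coisotropic (graph_bivector P) (mul_graph D)].

(* [X] is tangent to the fibres of the source map, and the differential of the
   left translation h |-> gh, which is defined on the source fibre through h,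
   maps X(h) to X(gh). *)
Definition left_invariant (R : realType) n m (G : manifold R n)
    (M : manifold R m) (D : groupoid_data G M) (X : G -> 'rV[R]_n) : Prop :=
  (forall g, X g *m jac (gsrc D) g = 0) /\
  forall g h, gtgt D g = gsrc D h ->
    forall c, curve_in [set k : G | gsrc D k = gsrc D h] c h (X h) ->
      velocity (fun t => gmul D g (c t)) = X (gmul D g h).

(* Structure on the trivial vector bundle of rank r over M, whose sections are
   the maps from M to R^r; the anchor maps u in the fibre over y to the
   tangent vector u *m anchor y. *)
Record algebroid_data (R : realType) m (M : manifold R m) (r : nat) :=
  AlgebroidData {
  abr : (M -> 'rV[R]_r) -> (M -> 'rV[R]_r) -> M -> 'rV[R]_r;
  anchor : M -> 'M[R]_(r, m)
}.

Definition anchor_act (R : realType) m (M : manifold R m) r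
    (rho : M -> 'M[R]_(r, m)) (X : M -> 'rV[R]_r) (f : M -> R) : M -> R :=
  fun y => vapp (X y *m rho y) f y.

Definition lie_algebroid (R : realType) m (M : manifold R m) r
    (A : algebroid_data M r) : Prop :=
  smoothmx (anchor A) /\
  forall X Y Z : M -> 'rV[R]_r, smoothv X -> smoothv Y -> smoothv Z ->
  [/\ smoothv (abr A X Y),
      forall y, abr A X (fun y => Y y + Z y) y = abr A X Y y + abr A X Z y,
      forall y, abr A X Y y = - abr A Y X y,
      forall y, abr A X (abr A Y Z) y + abr A Y (abr A Z X) y
                + abr A Z (abr A X Y) y = 0
    & forall f : M -> R, smooth f -> forall y,
        abr A X (fun y => f y *: Y y) y
        = f y *: abr A X Y y + anchor_act (anchor A) X f y *: Y y].

(* The bracket with anchor [rho] such that [e_i, e_j] = c y i j for the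
   standard frame e_0, ..., e_(r-1), extended by the Leibniz rule. *)
Definition frame_algebroid (R : realType) m (M : manifold R m) r
    (c : M -> 'I_r -> 'I_r -> 'rV[R]_r) (rho : M -> 'M[R]_(r, m)) :
    algebroid_data M r :=
  AlgebroidData
    (fun X Y y =>
      \sum_i \sum_j (X y 0 i * Y y 0 j) *: c y i j
      + \row_k (anchor_act rho X (fun z => Y z 0 k) y
                - anchor_act rho Y (fun z => X z 0 k) y))
    rho.

Definition frame (R : realType) m (M : manifold R m) r (i : 'I_r) :
    M -> 'rV[R]_r :=
  fun _ => delta_mx 0 i.

(* Below [A] and [As] are structures on a bundle and on its dual, in terms of
   dual frames; this is the resulting pairing. *)
Definition pairing (R : realType) m (M : manifold R m) r
    (X xi : M -> 'rV[R]_r) : M -> R :=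
  fun y => \sum_i X y 0 i * xi y 0 i.

Definition delta (R : realType) m (M : manifold R m) r
    (As : algebroid_data M r) (X xi eta : M -> 'rV[R]_r) : M -> R :=
  fun y => pairing X (abr As xi eta) y
    - anchor_act (anchor As) xi (pairing X eta) y
    + anchor_act (anchor As) eta (pairing X xi) y.

(* [delta X] as a section of the second exterior power, represented by the
   matrix of its values on the dual frame. *)
Definition delta_mx2 (R : realType) m (M : manifold R m) r
    (As : algebroid_data M r) (X : M -> 'rV[R]_r) : M -> 'M[R]_r :=
  fun y => \matrix_(i, j) delta As X (@frame R m M r i) (@frame R m M r j) y.

(* [delta] on functions. The sign is the one for which
   delta (f X) = f delta X + delta f /\ X. *)
Definition delta_fun (R : realType) m (M : manifold R m) r
    (As : algebroid_data M r) (f : M -> R) : M -> 'rV[R]_r :=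
  fun y => \row_i - anchor_act (anchor As) (@frame R m M r i) f y.

(* The Gerstenhaber bracket of X with
   Q = sum_(i < j) Q_ij e_i /\ e_j. In the other order, [Q, X] = - [X, Q]. *)
Definition gerst (R : realType) m (M : manifold R m) r
    (A : algebroid_data M r) (X : M -> 'rV[R]_r) (Q : M -> 'M[R]_r) :
    M -> 'M[R]_r :=
  fun y => \sum_(i < r) \sum_(j < r | (i < j)%N)
    (anchor_act (anchor A) X (fun z => Q z i j) y
       *: wedge (delta_mx 0 i) (delta_mx 0 j)
     + Q y i j *: (wedge (abr A X (@frame R m M r i) y) (delta_mx 0 j)
                   + wedge (delta_mx 0 i) (abr A X (@frame R m M r j) y))).

Definition lie_bialgebroid (R : realType) m (M : manifold R m) r
    (A As : algebroid_data M r) : Prop :=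
  [/\ lie_algebroid A, lie_algebroid As
    & forall X Y : M -> 'rV[R]_r, smoothv X -> smoothv Y -> forall y,
        delta_mx2 As (abr A X Y) y
        = - gerst A Y (delta_mx2 As X) y + gerst A X (delta_mx2 As Y) y].

(* Given vector fields [e i] on the groupoid, [linv e X] is
   sum_i (t^* X_i) e_i, and similarly for the second exterior power. *)
Definition linv (R : realType) n m (G : manifold R n) (M : manifold R m)
    (D : groupoid_data G M) r (e : 'I_r -> G -> 'rV[R]_n)
    (X : M -> 'rV[R]_r) : G -> 'rV[R]_n :=
  fun g => \sum_i X (gtgt D g) 0 i *: e i g.

Definition linv2 (R : realType) n m (G : manifold R n) (M : manifold R m)
    (D : groupoid_data G M) r (e : 'I_r -> G -> 'rV[R]_n)
    (Q : M -> 'M[R]_r) : G -> 'M[R]_n :=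
  fun g => \sum_(i < r) \sum_(j < r | (i < j)%N)
    Q (gtgt D g) i j *: wedge (e i g) (e j g).

(* The Lie algebroid ker(ds)|_M of the groupoid is A, the standard frame of A
   corresponding to the left-invariant vector fields [e i]. *)
Definition lie_algebroid_of (R : realType) n m (G : manifold R n)
    (M : manifold R m) (D : groupoid_data G M) r (A : algebroid_data M r)
    (e : 'I_r -> G -> 'rV[R]_n) : Prop :=
  let E y : 'M[R]_(r, n) := \matrix_(i < r) e i (gone D y) in
  [/\ forall i, smoothv (e i) /\ left_invariant D (e i),
      forall y, row_free (E y) /\
        forall v : 'rV[R]_n,
          (v <= E y)%MS <-> v *m jac (gsrc D) (gone D y) = 0,
      forall y, E y *m jac (gtgt D) (gone D y) = anchor A y
    & forall X Y : M -> 'rV[R]_r, smoothv X -> smoothv Y ->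
      forall f : G -> R, smooth f -> forall g,
        vapp (linv D e (abr A X Y) g) f g
        = vapp (linv D e X g) (fun h => vapp (linv D e Y h) f h) g
          - vapp (linv D e Y g) (fun h => vapp (linv D e X h) f h) g].

(* The last two clauses are delta(f)(dg) = {g, f} and
   delta(X)(df, dg) = {Xf, g} + {f, Xg} - X{f, g}. *)
Definition lie_bialgebroid_of (R : realType) n m (G : manifold R n)
    (M : manifold R m) (D : groupoid_data G M) (P : G -> 'M[R]_n) r
    (A As : algebroid_data M r) (e : 'I_r -> G -> 'rV[R]_n) : Prop :=
  [/\ lie_algebroid_of D A e,
      forall f : M -> R, smooth f -> forall g : G -> R, smooth g -> forall p,
        vapp (linv D e (delta_fun As f) p) g p
        = pbracket P g (f \o gtgt D) p
    & forall X : M -> 'rV[R]_r, smoothv X ->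
      let XL (f : G -> R) : G -> R := fun p => vapp (linv D e X p) f p in
      forall f g : G -> R, smooth f -> smooth g -> forall p,
        bivapp (linv2 D e (delta_mx2 As X) p) f g p
        = pbracket P (XL f) g p + pbracket P f (XL g) p
          - XL (pbracket P f g) p].

Definition mx2 (R : realType) (a b c d : R[i]) : 'M[R[i]]_2 :=
  \matrix_(i, j) if i == 0 then (if j == 0 then a else b)
                 else (if j == 0 then c else d).

(* In R[i], [0 < z] means that z is real and positive. *)
Definition inB (R : realType) (g : 'M[R[i]]_2) : bool :=
  [&& 0 < g 0 0, g 0 1 == 0 & g 1 1 == (g 0 0)^-1].

Definition B (R : realType) : Type := {g : 'M[R[i]]_2 | inB g}.

Lemma mx2P (R : realType) (g h : 'M[R[i]]_2) :
  [/\ g 0 0 = h 0 0, g 0 1 = h 0 1, g 1 0 = h 1 0 & g 1 1 = h 1 1] -> g = h.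
Proof.
case=> h00 h01 h10 h11; apply/matrixP=> i j.
have o2 (k : 'I_2) : k = 0 \/ k = 1.
  by case: k => [[|[|//]] lk]; [left|right]; apply/val_inj.
by case: (o2 i) => ->; case: (o2 j) => ->.
Qed.

Lemma mul2E (R : realType) (g h : 'M[R[i]]_2) i j :
  (g *m h) i j = g i 0 * h 0 j + g i 1 * h 1 j.
Proof.
rewrite mxE big_ord_recl big_ord1.
by congr (_ + g i _ * h _ j); apply/val_inj.
Qed.

Lemma inB1 (R : realType) : inB (1%:M : 'M[R[i]]_2).
Proof. by rewrite /inB !mxE /= ltr01 invr1 !eqxx. Qed.

Lemma inBM (R : realType) (g h : 'M[R[i]]_2) :
  inB g -> inB h -> inB (g *m h).
Proof.
case/and3P=> g0 /eqP g01 /eqP g11 /and3P[h0 /eqP h01 /eqP h11].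
rewrite /inB !mul2E g01 h01 g11 h11 !mul0r !mulr0 !addr0 add0r eqxx /=.
by rewrite mulr_gt0 // invfM eqxx.
Qed.

Lemma invBE (R : realType) (g : 'M[R[i]]_2) : inB g ->
  invmx g = mx2 (g 0 0)^-1 0 (- g 1 0) (g 0 0).
Proof.
case/and3P=> g0 /eqP g01 /eqP g11; have gN := lt0r_neq0 g0.
set h := mx2 _ _ _ _.
have hg : h *m g = 1%:M.
  apply: mx2P; rewrite !mul2E /h !mxE /= g01 g11 !mulr0 !mul0r !addr0 !add0r.
  by rewrite mulVf // mulfV // mulNr (mulrC (g 1 0)) addNr.
have [_ ug] := mulmx1_unit hg.
by rewrite -[LHS]mul1mx -hg mulmxK.
Qed.

Lemma inBV (R : realType) (g : 'M[R[i]]_2) : inB g -> inB (invmx g).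
Proof.
move=> gB; rewrite (invBE gB); case/and3P: gB => g0 _ _.
by rewrite /inB !mxE /= invr_gt0 g0 eqxx invrK /=.
Qed.

Definition oneB (R : realType) : B R :=
  exist (fun k => inB k) _ (@inB1 R).
Definition mulB (R : realType) (g h : B R) : B R :=
  exist (fun k => inB k) _ (inBM (svalP g) (svalP h)).
Definition invB (R : realType) (g : B R) : B R :=
  exist (fun k => inB k) _ (inBV (svalP g)).

(* Real coordinates (x, a, Re z, Im z, y). This is a real-linear map on
   R x M_2(C) x R, so it is its own differential: it sends a tangent vector of
   R x B x R, seen in R x M_2(C) x R, to its components in the chart [BR]. *)
Definition BRcrd (R : realType) (x : R) (g : 'M[R[i]]_2) (y : R) : 'rV[R]_5 :=
  \row_j nth 0 [:: x; complex.Re (g 0 0); complex.Re (g 1 0); complex.Im (g 1 0); y] j.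

Definition BRprm (R : realType) (v : 'rV[R]_5) : R * B R * R :=
  let a := (v 0 1)%:C%C in
  (v 0 0, insubd (oneB R) (mx2 a 0 (v 0 2 +i* v 0 3)%C a^-1), v 0 4).

Lemma BR_crdK (R : realType) :
  cancel (fun p : R * B R * R => BRcrd p.1.1 (sval p.1.2) p.2) (@BRprm R).
Proof.
case=> [[x [g gB]] y]; rewrite /BRprm /= !mxE /=.
congr (_, _, _); apply: val_inj => /=.
case/and3P: (gB) => g0 /eqP g01 /eqP g11.
have ga : (complex.Re (g 0 0))%:C%C = g 0 0.
  by apply: RRe_real; rewrite realE (ltW g0).
suff -> : mx2 (complex.Re (g 0 0))%:C%C 0 (complex.Re (g 1 0) +i* complex.Im (g 1 0))%C
  ((complex.Re (g 0 0))%:C%C)^-1 = g by rewrite insubdK.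
by apply: mx2P; rewrite !mxE /= ga g01 g11; split=> //; case: (g 1 0).
Qed.

Lemma BR_crd_open (R : realType) :
  open (range (fun p : R * B R * R => BRcrd p.1.1 (sval p.1.2) p.2)).
Proof.
rewrite [X in open X](_ : _ =
  (fun v : 'rV[R]_5 => v 0 1) @^-1` [set a : R | 0 < a]).
  by apply: open_comp => [v _|]; [exact: coord_continuous|exact: open_gt].
apply/seteqP; split=> [v [[[x [g gB]] y] _ <-] /=|v /= v0].
  case/and3P: gB => g0 _ _; rewrite !mxE /=.
  by move: g0; rewrite ltcE => /andP[].
have gB : inB (mx2 (v 0 1)%:C%C 0 (v 0 2 +i* v 0 3)%C ((v 0 1)%:C%C)^-1).
  by rewrite /inB !mxE /= !eqxx ltcR v0.
exists (v 0 0, exist (fun k => inB k) _ gB, v 0 4) => //=.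
apply/rowP=> -[[|[|[|[|[|//]]]]] lj]; rewrite !mxE /=;
  by congr (v 0 _); apply: val_inj.
Qed.

Definition BR (R : realType) : manifold R 5 :=
  Manifold (@BR_crdK R) (@BR_crd_open R).

Definition BR_groupoid (R : realType) : groupoid_data (BR R) (line R) :=
  @GroupoidData R 5 1 (BR R) (line R)
    (fun p => p.1.1)
    (fun p => p.2)
    (fun p q => (p.1.1, mulB p.1.2 q.1.2, q.2))
    (fun x => (x, oneB R, x))
    (fun p => (p.2, invB p.1.2, p.1.1)).

Definition PiB (R : realType) (p : BR R) : 'M[R]_5 :=
  let: (x, g, y) := p in
  let a := sval g 0 0 in
  let z := sval g 1 0 in
  let vec (X : 'M[R[i]]_2) := BRcrd 0 X 0 in
  wedge (vec (mx2 0 0 ('i%C * z) 0)) (vec (mx2 (- a) 0 0 a^-1))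
  + (4^-1 * (x * complex.Re a ^+ 2 - y * complex.Re a ^- 2))
      *: wedge (vec (mx2 0 0 'i%C 0)) (vec (mx2 0 0 1 0)).

Definition Jhat (R : realType) (i : nat) : 'M[R[i]]_2 :=
  match i with
  | 1%N => 2^-1 *: mx2 (- 1) 0 0 1
  | 2%N => 2^-1 *: mx2 0 0 'i%C 0
  | 3%N => 2^-1 *: mx2 0 0 1 0
  | _ => 0
  end.

(* The left-invariant vector fields on B_R of the frame
   Jhat_0 = (0, 2 d/dy), Jhat_i = (Jhat_i, 0). *)
Definition BR_frame (R : realType) (i : 'I_4) (p : BR R) : 'rV[R]_5 :=
  if i == 0 then BRcrd 0 0 2 else BRcrd 0 (sval p.1.2 *m Jhat R i) 0.

Definition BR_algebroid (R : realType) : algebroid_data (line R) 4 :=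
  let J k : 'rV[R]_4 := delta_mx 0 k in
  @frame_algebroid R 1 (line R) 4
    (fun _ i j =>
      match (i : nat), (j : nat) with
      | 1%N, 2%N => J 2
      | 2%N, 1%N => - J 2
      | 1%N, 3%N => J 3
      | 3%N, 1%N => - J 3
      | _, _ => 0
      end)
    (fun _ => \matrix_(i, j) if i == 0 then 2 else 0).

Definition AR_algebroid (R : realType) : algebroid_data (line R) 4 :=
  let J k : 'rV[R]_4 := delta_mx 0 k in
  @frame_algebroid R 1 (line R) 4
    (fun y i j =>
      match (i : nat), (j : nat) with
      | 1%N, 2%N => 2 *: J 3
      | 2%N, 1%N => - (2 *: J 3)
      | 2%N, 3%N => (2 * (y : R)) *: J 1 + 2 *: J 0
      | 3%N, 2%N => - ((2 * (y : R)) *: J 1 + 2 *: J 0)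
      | 3%N, 1%N => 2 *: J 2
      | 1%N, 3%N => - (2 *: J 2)
      | _, _ => 0
      end)
    (fun _ => 0).

(* Main.v *)
Require Import Defs.
From mathcomp Require Import all_boot all_order all_algebra.
From mathcomp Require Import all_classical all_reals all_analysis.
From mathcomp Require Import complex ring lra.

Set Implicit Arguments.
Unset Strict Implicit.
Unset Printing Implicit Defensive.

Import Order.TTheory GRing.Theory Num.Theory.
Import numFieldNormedType.Exports.

Local Open Scope classical_set_scope.
Local Open Scope ring_scope.

(** Write (x, a, u, v, y) for the coordinates of (x, g, y), where a is the upper
left entry of g and u + i v the lower left one. In these coordinates
  {a, u} = - a v,  {a, v} = a u,  {u, v} = - (x a ^ 2 - y / a ^ 2) / 4,
while x and y Poisson commute with everything, and the product of (x, g, y) and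
(y, h, z), whose upper left entries are a and b, is
  (x, a b, u b + u' / a, v b + v' / a, z).

The Jacobi identity ([PiB_jacobi]): on arbitrary functions the terms that
contain second derivatives cancel, because these are symmetric ([pdC], from
[deriveC]); what is left is the identity for a, u, v. There {a, {u, v}} = 0,
since {u, v} depends on no coordinate other than x, a, y, and
{u, {v, a}} + {v, {a, u}} = - {u, a u} - {v, a v} = - a u v + a u v = 0.

Multiplicativity ([mul_graph_coisotropic]): the graph of the multiplication is
the regular zero set of the six functions [graph_eq], and every pair of
velocities of the two factors that agree on the middle unit is realized by a
curve in it ([tangent_mul_graph]). A covector that annihilates the velocities of
these curves has its a, u, v components along the factors determined by those
along the product; its image under the bivector is again the velocity of such a
curve. The decisive identity is
  x (a b) ^ 2 - z / (a b) ^ 2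
    = b ^ 2 (x a ^ 2 - y / a ^ 2) + (y b ^ 2 - z / b ^ 2) / a ^ 2,
in which the coordinate y of the middle unit disappears.

The Lie bialgebroid: the left-invariant fields of the frame are 2 d/dy,
- (a d/da + u d/du + v d/dv) / 2, (2 a)^-1 d/dv and (2 a)^-1 d/du. Their
commutators ([linv_act_commutator]) and the formula for delta
([delta_bracket]) are again compared on arbitrary functions, where second
derivatives cancel by symmetry. The compatibility of delta with the bracket
([BR_lie_bialgebroid]) is an identity between three coefficients, since the
bivectors delta(X) only involve e_1 /\ e_2, e_1 /\ e_3 and e_2 /\ e_3
([gerst_wedge]). *)

(** * Symmetry of second derivatives *)

Lemma is_derive_line (R : realType) (V : normedModType R) (f : V -> R)
    (u z : V) (s : R) : derivable f (s *: u + z) u ->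
  is_derive s 1 (fun r : R => f (r *: u + z)) ('D_u f (s *: u + z)).
Proof.
have E : (fun h : R => h^-1 *:
      (((fun r : R => f (r *: u + z)) \o shift s) (h *: 1) - f (s *: u + z)))
    = (fun h : R => h^-1 *:
      ((f \o shift (s *: u + z)) (h *: u) - f (s *: u + z))).
  by apply/funext => h /=; rewrite [h%:A]mulr1 scalerDl addrA.
by move=> df; split; rewrite /derivable /derive E.
Qed.

(** The mean value theorem, first along [u] and then along [v]. *)
Lemma second_difference (R : realType) (V : normedModType R) (f : V -> R)
    (u v x : V) (h : R) : 0 < h ->
  (forall s t, 0 <= s <= h -> 0 <= t <= h ->
    derivable f (s *: u + (t *: v + x)) u /\
    derivable ('D_u f) (t *: v + (s *: u + x)) v) ->
  exists s t, [/\ 0 <= s <= h, 0 <= t <= h &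
    f (h *: u + (h *: v + x)) - f (h *: u + x) - f (h *: v + x) + f x
    = 'D_v ('D_u f) (t *: v + (s *: u + x)) * h ^+ 2].
Proof.
move=> h0 H.
have hh : 0 <= h <= h by rewrite lexx ltW.
have h00 : 0 <= (0 : R) <= h by rewrite lexx ltW.
pose phi (s : R) := f (s *: u + (h *: v + x)) - f (s *: u + x).
pose dphi (s : R) := 'D_u f (s *: u + (h *: v + x)) - 'D_u f (s *: u + x).
have dphiP s : 0 <= s <= h -> is_derive s 1 phi (dphi s).
  move=> sh; apply: is_deriveB; apply: is_derive_line.
    exact: (H s h sh hh).1.
  by have := (H s 0 sh h00).1; rewrite scale0r add0r.
have [||s] := MVT (f := phi) (df := dphi) h0.
- by move=> s; rewrite in_itv => /andP[a b]; apply: dphiP; rewrite !ltW.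
- apply: derivable_within_continuous => s; rewrite in_itv /= => sh.
  by case: (dphiP s sh).
rewrite in_itv /= => /andP[s0 sh]; rewrite subr0 => Es.
have sP : 0 <= s <= h by rewrite !ltW.
pose psi (t : R) := 'D_u f (t *: v + (s *: u + x)).
pose dpsi (t : R) := 'D_v ('D_u f) (t *: v + (s *: u + x)).
have dpsiP t : 0 <= t <= h -> is_derive t 1 psi (dpsi t).
  by move=> th; apply: is_derive_line; exact: (H s t sP th).2.
have [||t] := MVT (f := psi) (df := dpsi) h0.
- by move=> t; rewrite in_itv => /andP[a b]; apply: dpsiP; rewrite !ltW.
- apply: derivable_within_continuous => t; rewrite in_itv /= => th.
  by case: (dpsiP t th).
rewrite in_itv /= => /andP[t0 th]; rewrite subr0 => Et.
exists s, t; split; rewrite ?ltW //.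
rewrite -/(dpsi t) expr2 mulrA -Et.
have -> : psi h - psi 0 = dphi s.
  by rewrite /psi /dphi scale0r add0r addrCA.
by rewrite -Es /phi !scale0r !add0r; ring.
Qed.

Lemma nbhs_square (R : realType) (V : normedModType R) (u v x : V)
    (N : set V) : nbhs x N ->
  exists2 h : R, 0 < h & forall s t, 0 <= s <= h -> 0 <= t <= h ->
    N (s *: u + (t *: v + x)).
Proof.
move=> /nbhs_normP[e /= e0 eN].
have c0 : 0 < `|u| + `|v| + 1 by rewrite ltr_wpDl // addr_ge0.
exists (e / (`|u| + `|v| + 1)); first by rewrite divr_gt0.
move=> s t /andP[s0 sh] /andP[t0 th]; apply: eN => /=.
rewrite addrA opprD addrCA subrr addr0 normrN.
apply: le_lt_trans (ler_normD _ _) _; rewrite !normrZ !ger0_norm //.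
have -> : e = e / (`|u| + `|v| + 1) * (`|u| + `|v| + 1).
  by rewrite divfK // gt_eqF.
set h := e / _ in sh th *.
have h0 : 0 < h by rewrite divr_gt0.
rewrite mulrDr mulr1 mulrDr ltr_pwDr // lerD // ler_wpM2r //.
Qed.

Lemma close_of_common (R : realFieldType) (p q p' q' e : R) : p' = q' ->
  `|p - p'| < e / 2 -> `|q - q'| < e / 2 -> `|p - q| <= e.
Proof.
move=> <- pp' qp'; rewrite -(subrKA p') (splitr e).
by apply: le_trans (ler_normD _ _) _; rewrite lerD ?ltW // distrC.
Qed.

(** The second difference of [f] over a small parallelogram is symmetric in [u]
and [v]; by [second_difference] it is [h ^+ 2] times a value near [x] of either
mixed derivative, and both of these are continuous at [x]. *)
Lemma deriveC (R : realType) (V : normedModType R) (U : set V) (f : V -> R)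
    (u v x : V) : open U -> U x ->
  (forall y, U y -> derivable f y u /\ derivable f y v) ->
  (forall y, U y -> derivable ('D_u f) y v /\ derivable ('D_v f) y u) ->
  {for x, continuous ('D_v ('D_u f))} -> {for x, continuous ('D_u ('D_v f))} ->
  'D_v ('D_u f) x = 'D_u ('D_v f) x.
Proof.
move=> oU Ux d1 d2 c1 c2; apply/eqP; rewrite -subr_eq0 -normr_le0.
apply/ler_addgt0Pl => e e0; rewrite addr0.
have e2 : 0 < e / 2 by rewrite divr_gt0.
have /cvgr_dist_lt/(_ _ e2) N1 := c1; have /cvgr_dist_lt/(_ _ e2) N2 := c2.
have [h h0 hN] := nbhs_square u v
  (filterI (open_nbhs_nbhs (conj oU Ux)) (filterI N1 N2)).
have hU s t (sh : 0 <= s <= h) (th : 0 <= t <= h) : U (s *: u + (t *: v + x)).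
  by have [] := hN s t sh th.
have [|s1 [t1 [s1h t1h E1]]] := @second_difference R V f u v x h h0.
  move=> s t sh th; split; first by apply: (d1 _ (hU _ _ sh th)).1.
  by rewrite addrCA; apply: (d2 _ (hU _ _ sh th)).1.
have [|s2 [t2 [s2h t2h E2]]] := @second_difference R V f v u x h h0.
  move=> s t sh th; split; last by apply: (d2 _ (hU _ _ th sh)).2.
  by rewrite addrCA; apply: (d1 _ (hU _ _ th sh)).2.
have [_ [+ _]] := hN _ _ s1h t1h; have [_ [_ +]] := hN _ _ t2h s2h => /=.
have E : 'D_v ('D_u f) (s1 *: u + (t1 *: v + x))
    = 'D_u ('D_v f) (t2 *: u + (s2 *: v + x)).
  apply: (mulIf (x := h ^+ 2)); first by rewrite expf_neq0 // gt_eqF.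
  have -> : s1 *: u + (t1 *: v + x) = t1 *: v + (s1 *: u + x) by exact: addrCA.
  apply: etrans (esym E1) (etrans _ E2).
  have -> : h *: u + (h *: v + x) = h *: v + (h *: u + x) by exact: addrCA.
  by congr (_ + _); exact: addrAC.
move=> b a; exact: (close_of_common E a b).
Qed.

(** * Functions of class C^k on open subsets of R^n *)

Lemma near_eq_open (R : realType) n (U : set 'rV[R]_n) (f g : 'rV[R]_n -> R) x :
  open U -> (forall y, U y -> f y = g y) -> U x -> \near x, f x = g x.
Proof.
move=> oU fg Ux; have := open_nbhs_nbhs (conj oU Ux).
by apply: filterS.
Qed.

Lemma continuous_eq_open (R : realType) n (U : set 'rV[R]_n)
    (f g : 'rV[R]_n -> R) x : open U -> (forall y, U y -> f y = g y) -> U x ->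
  {for x, continuous f} -> {for x, continuous g}.
Proof.
move=> oU fg Ux cf; rewrite /prop_for /continuous_at -(fg x Ux).
apply: cvg_trans cf; apply: (near_eq_cvg (F := nbhs x)).
exact: near_eq_open oU fg Ux.
Qed.

(** Derivatives are local, which allows a function on a manifold to be replaced
by any formula for it in the chart. *)
Lemma Ck_eq (R : realType) n k (U : set 'rV[R]_n) (f g : 'rV[R]_n -> R) :
  open U -> (forall x, U x -> f x = g x) -> Ck k U f -> Ck k U g.
Proof.
move=> oU; elim: k f g => [|k IH] f g fg [cf df].
  by split=> // x Ux; exact: continuous_eq_open oU fg Ux (cf x Ux).
split=> [x Ux|i]; first exact: continuous_eq_open oU fg Ux (cf x Ux).
have [dfi Cfi] := df i; split=> [x Ux|].
  exact: near_eq_derivable (near_eq_open oU fg Ux) (dfi x Ux).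
apply: IH Cfi => x Ux; apply: near_eq_derive.
exact: near_eq_open oU fg Ux.
Qed.

Lemma Ck_S (R : realType) n k (U : set 'rV[R]_n) (f : 'rV[R]_n -> R) :
  Ck k.+1 U f -> Ck k U f.
Proof.
elim: k f => [|k IH] f [cf df]; first by split.
by split=> // i; have [d1 /IH] := df i.
Qed.

Lemma CkD (R : realType) n k (U : set 'rV[R]_n) (f g : 'rV[R]_n -> R) :
  open U -> Ck k U f -> Ck k U g -> Ck k U (fun x => f x + g x).
Proof.
move=> oU; elim: k f g => [|k IH] f g [cf df] [cg dg].
  by split=> // x Ux; exact: continuousD (cf x Ux) (cg x Ux).
split=> [x Ux|i]; first by exact: continuousD (cf x Ux) (cg x Ux).
have [dfi Cfi] := df i; have [dgi Cgi] := dg i; split=> [x Ux|].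
  exact: derivableD (dfi x Ux) (dgi x Ux).
apply: Ck_eq (IH _ _ Cfi Cgi) => // x Ux.
exact: esym (deriveD (dfi x Ux) (dgi x Ux)).
Qed.

Lemma CkM (R : realType) n k (U : set 'rV[R]_n) (f g : 'rV[R]_n -> R) :
  open U -> Ck k U f -> Ck k U g -> Ck k U (fun x => f x * g x).
Proof.
move=> oU; elim: k f g => [|k IH] f g.
  move=> [cf _] [cg _].
  by split=> // x Ux; exact: continuousM (cf x Ux) (cg x Ux).
move=> Cf Cg; have Cf' := Ck_S Cf; have Cg' := Ck_S Cg.
case: Cf Cg => cf df [cg dg].
split=> [x Ux|i]; first by exact: continuousM (cf x Ux) (cg x Ux).
have [dfi Cfi] := df i; have [dgi Cgi] := dg i; split=> [x Ux|].
  exact: derivableM (dfi x Ux) (dgi x Ux).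
apply: Ck_eq (CkD oU (IH _ _ Cf' Cgi) (IH _ _ Cg' Cfi)) => // x Ux.
exact: esym (deriveM (dfi x Ux) (dgi x Ux)).
Qed.

Lemma Ck_cst (R : realType) n k (U : set 'rV[R]_n) (c : R) :
  Ck k U (fun=> c).
Proof.
elim: k c => [|k IH] c; first by split=> // x Ux; exact: cst_continuous.
split=> [x Ux|i]; first exact: cst_continuous.
split=> [x Ux|]; first exact: derivable_cst.
rewrite [X in Ck _ _ X](_ : _ = fun=> 0) //.
by apply/funext => x; exact: derive_cst.
Qed.

(** By induction on the order, since the derivative of [1 / f] is the product of
[- 1], [1 / f] twice and a derivative of [f]. *)
Lemma CkV (R : realType) n k (U : set 'rV[R]_n) (f : 'rV[R]_n -> R) :
  open U -> (forall x, U x -> f x != 0) -> Ck k U f ->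
  Ck k U (fun x => (f x)^-1).
Proof.
move=> oU f0; elim: k => [|k IH].
  move=> [cf _].
  by split=> // x Ux; exact: continuousV (f0 x Ux) (cf x Ux).
move=> Cf; have Cf' := IH (Ck_S Cf); case: Cf => cf df.
split=> [x Ux|i]; first by exact: continuousV (f0 x Ux) (cf x Ux).
have [dfi Cfi] := df i; split=> [x Ux|].
  by exact: derivableV (f0 x Ux) (dfi x Ux).
apply: Ck_eq (CkM oU (Ck_cst k U (-1)) (CkM oU (CkM oU Cf' Cf') Cfi)) => // x Ux.
rewrite (deriveV (f0 x Ux) (dfi x Ux)).
by rewrite mulN1r -mulNr -exprVn expr2.
Qed.

(** The coordinate takes values in R^1, the model space of a line, so that
functions on the base of the groupoid can be pulled back along it. *)
Definition pull_coord (R : realType) n (k : 'I_n) (v : 'rV[R]_n) : 'rV[R]_1 :=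
  \row_(_ < 1) v 0 k.

Lemma is_derive_pull (R : realType) n (k i : 'I_n) (f : 'rV[R]_1 -> R)
    (x : 'rV[R]_n) : derivable f (pull_coord k x) (delta_mx 0 0) ->
  is_derive x (delta_mx 0 i) (f \o pull_coord k)
    ((i == k)%:R * 'D_(delta_mx 0 0) f (pull_coord k x)).
Proof.
move=> df; case: (eqVneq i k) => [->|ik].
  have E : (fun h : R => h^-1 *: (((f \o pull_coord k) \o shift x)
        (h *: delta_mx 0 k) - (f \o pull_coord k) x))
    = (fun h : R => h^-1 *: ((f \o shift (pull_coord k x))
        (h *: delta_mx 0 0) - f (pull_coord k x))).
    apply/funext => h /=; congr (_ *: (f _ - _)); apply/rowP => j.
    by rewrite !mxE (ord1 j) !eqxx.
  by split; rewrite /derivable /derive E // mul1r.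
have E : (fun h : R => h^-1 *: (((f \o pull_coord k) \o shift x)
      (h *: delta_mx 0 i) - (f \o pull_coord k) x)) = cst 0.
  apply/funext => h /=; rewrite [X in f X](_ : _ = pull_coord k x).
    by rewrite subrr scaler0.
  by apply/rowP => j; rewrite !mxE eq_sym (negbTE ik) andbF mulr0 add0r.
rewrite mul0r.
split; rewrite /derivable /derive E; first exact: is_cvg_cst.
exact: lim_cst.
Qed.

Lemma continuous_pull (R : realType) n (k : 'I_n) :
  continuous (@pull_coord R n k).
Proof.
move=> x A [e /= e0 eA].
have := e0 0 0; rewrite mxE => e00.
have FF : Filter (nbhs x) by exact: nbhs_filter.
have : nbhs x [set w : 'rV[R]_n | e 0 0 (w 0 k)].
  exact: (@coord_continuous R 1 n 0 k x _ e00).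
apply: filterS => w ew; apply: eA => i j.
by rewrite (ord1 i) (ord1 j) mxE.
Qed.

Lemma Ck_pull (R : realType) n m (k : 'I_n) (U : set 'rV[R]_n)
    (f : 'rV[R]_1 -> R) :
  open U -> Ck m setT f -> Ck m U (f \o pull_coord k).
Proof.
move=> oU.
have cp := @continuous_pull R n k.
elim: m f => [|m IH] f [cf df].
  split=> // x Ux; apply: (continuous_comp (cp x)); exact: cf.
split=> [x Ux|i]; first by apply: (continuous_comp (cp x)); exact: cf.
have [df0 Cf0] := df 0.
have D x := @is_derive_pull R n k i f x (df0 _ I).
split=> [x Ux|]; first by case: (D x).
apply: Ck_eq (CkM oU (Ck_cst m U (i == k)%:R) (IH _ Cf0)) => // x Ux.
by have [_ ->] := D x.
Qed.

Lemma is_derive_crd1 (R : realType) (x : 'rV[R]_1) :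
  is_derive x (delta_mx 0 0) (fun v : 'rV[R]_1 => v 0 0) (1 : R).
Proof.
have C : h^-1 *: (((fun v : 'rV[R]_1 => v 0 0) \o shift x) (h *: delta_mx 0 0)
    - x 0 0) @[h --> 0^'] --> (1 : R).
  apply: cvg_near_cst; near=> h; rewrite /= !mxE !eqxx mulr1 addrK.
  by rewrite /GRing.scale /= mulVf //; near: h; exact: nbhs_dnbhs_neq.
by split; [apply/cvg_ex; exists 1|exact: cvg_lim C].
Unshelve. all: by end_near. Qed.

Lemma Ck_id1 (R : realType) m (U : set 'rV[R]_1) : Ck m U (fun v => v 0 0).
Proof.
case: m => [|m]; first by split=> // x _; exact: coord_continuous.
split=> [x _|i]; first exact: coord_continuous.
rewrite (ord1 i); split=> [x _|]; first by case: (is_derive_crd1 x).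
rewrite [X in Ck _ _ X](_ : _ = fun=> 1); first exact: Ck_cst.
by apply/funext => x; case: (is_derive_crd1 x).
Qed.

(** * Smooth functions on a manifold with a global chart *)

Lemma crd_prmK (R : realType) n (M : manifold R n) v :
  (range (@crd R n M)) v -> crd (prm v : M) = v.
Proof. by case=> p _ <-; rewrite crdK. Qed.

Lemma smooth_in_derivable (R : realType) n (M : manifold R n) (W : set M)
    (f : M -> R) (i : 'I_n) (p : M) :
  smooth_in W f -> W p -> derivable (f \o prm) (crd p) (delta_mx 0 i).
Proof. by move=> sf Wp; have [_ df] := sf 1%N; apply: (df i).1; exists p. Qed.

Lemma smooth_derivable (R : realType) n (M : manifold R n) (f : M -> R)
    (i : 'I_n) (p : M) :
  smooth f -> derivable (f \o prm) (crd p) (delta_mx 0 i).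
Proof.
by move=> sf; exact: (@smooth_in_derivable R n M setT f i p sf I).
Qed.

Arguments smooth_derivable {R n M f} i p _.

(** A formula in coordinates need only represent [f] on the range of the chart:
[prm] is arbitrary outside, but the range is open. *)
Lemma smooth_eq_chart (R : realType) n (M : manifold R n) (f : M -> R)
    (F : 'rV[R]_n -> R) : (forall p : M, F (crd p) = f p) ->
  Cinfty (range (@crd R n M)) F -> smooth f.
Proof.
move=> Ff CF k; apply: Ck_eq (CF k); first exact: crd_open.
by move=> _ [p _ <-]; rewrite Ff /= crdK.
Qed.

Lemma pd_eq_chart (R : realType) n (M : manifold R n) (f : M -> R)
    (F : 'rV[R]_n -> R) i (p : M) : (forall p : M, F (crd p) = f p) ->
  pd f i p = 'D_(delta_mx 0 i) F (crd p).
Proof.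
move=> Ff; apply: near_eq_derive.
apply: (near_eq_open (@crd_open _ _ M)); last by exists p.
by move=> _ [q _ <-]; rewrite Ff /= crdK.
Qed.

Lemma smoothD (R : realType) n (M : manifold R n) (f g : M -> R) :
  smooth f -> smooth g -> smooth (fun p => f p + g p).
Proof. by move=> sf sg k; exact: CkD (@crd_open _ _ M) (sf k) (sg k). Qed.

Lemma smoothM (R : realType) n (M : manifold R n) (f g : M -> R) :
  smooth f -> smooth g -> smooth (fun p => f p * g p).
Proof. by move=> sf sg k; exact: CkM (@crd_open _ _ M) (sf k) (sg k). Qed.

Lemma smooth_cst (R : realType) n (M : manifold R n) (c : R) :
  smooth (fun _ : M => c).
Proof. by move=> k; exact: Ck_cst. Qed.

Lemma smoothN (R : realType) n (M : manifold R n) (f : M -> R) :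
  smooth f -> smooth (fun p => - f p).
Proof.
move=> sf; rewrite (_ : (fun p => - f p) = fun p => -1 * f p).
  by apply: smoothM => //; exact: smooth_cst.
by apply/funext => p; rewrite mulN1r.
Qed.

Lemma smoothV (R : realType) n (M : manifold R n) (f : M -> R) :
  (forall p, f p != 0) -> smooth f -> smooth (fun p => (f p)^-1).
Proof.
move=> f0 sf k; apply: CkV (@crd_open _ _ M) _ (sf k).
by move=> x _; exact: f0.
Qed.

Lemma smooth_line_crd (R : realType) n (M : manifold R n) (k : 'I_n)
    (f : line R -> R) : smooth f -> smooth (fun p : M => f (crd p 0 k)).
Proof.
move=> sf; apply: (smooth_eq_chart (F := (f \o prm) \o pull_coord k)).
  by move=> p /=; rewrite mxE.
move=> m; apply: Ck_pull; first exact: crd_open.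
have := sf m; congr Ck; apply/seteqP; split=> // v _.
by exists (v 0 0) => //; apply/rowP => j; rewrite mxE (ord1 j).
Qed.

Lemma smooth_id_line (R : realType) : smooth (fun t : line R => t : R).
Proof. by move=> k; exact: Ck_id1. Qed.

Lemma smooth_crd (R : realType) n (M : manifold R n) (k : 'I_n) :
  smooth (fun p : M => crd p 0 k).
Proof. exact: (@smooth_line_crd R n M k _ (@smooth_id_line R)). Qed.

Lemma smooth_pd (R : realType) n (M : manifold R n) (f : M -> R) i :
  smooth f -> smooth (pd f i).
Proof.
move=> sf; apply: (smooth_eq_chart (F := 'D_(delta_mx 0 i) (f \o prm))) => //.
by move=> k; have [_ df] := sf k.+1; exact: (df i).2.
Qed.

Lemma pd_cst (R : realType) n (M : manifold R n) (c : R) i (p : M) :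
  pd (fun=> c) i p = 0.
Proof. exact: derive_cst. Qed.

Lemma pdD (R : realType) n (M : manifold R n) (f g : M -> R) i (p : M) :
  smooth f -> smooth g -> pd (fun q => f q + g q) i p = pd f i p + pd g i p.
Proof.
move=> sf sg.
by have := deriveD (smooth_derivable i p sf) (smooth_derivable i p sg).
Qed.

Lemma pdM (R : realType) n (M : manifold R n) (f g : M -> R) i (p : M) :
  smooth f -> smooth g ->
  pd (fun q => f q * g q) i p = pd f i p * g p + f p * pd g i p.
Proof.
move=> sf sg; rewrite addrC (mulrC (pd f i p)).
have := deriveM (smooth_derivable i p sf) (smooth_derivable i p sg).
by rewrite /= !crdK.
Qed.

Lemma pdN (R : realType) n (M : manifold R n) (f : M -> R) i (p : M) :
  smooth f -> pd (fun q => - f q) i p = - pd f i p.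
Proof. by move=> sf; have := deriveN (smooth_derivable i p sf). Qed.

Lemma pdV (R : realType) n (M : manifold R n) (f : M -> R) i (p : M) :
  (forall q, f q != 0) -> smooth f ->
  pd (fun q => (f q)^-1) i p = - (pd f i p / f p ^+ 2).
Proof.
move=> f0 sf; have := deriveV (f0 (prm (crd p))) (smooth_derivable i p sf).
by move=> E; apply: etrans E _; rewrite /GRing.scale /= crdK mulNr mulrC.
Qed.

Lemma pd_line_crd (R : realType) n (M : manifold R n) (k i : 'I_n)
    (f : line R -> R) (p : M) : smooth f ->
  pd (fun q : M => f (crd q 0 k)) i p = (i == k)%:R * pd f 0 (crd p 0 k).
Proof.
move=> sf; have E : (\row_(_ < 1) crd p 0 k) = pull_coord k (crd p) by [].
rewrite (@pd_eq_chart _ _ M _ ((f \o prm) \o pull_coord k)); last first.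
  by move=> q /=; rewrite mxE.
have df := smooth_derivable 0 (crd p 0 k : line R) sf.
by case: (is_derive_pull i df).
Qed.

Lemma pd_id_line (R : realType) (t : line R) :
  pd (fun s : line R => s : R) 0 t = 1.
Proof. by case: (is_derive_crd1 (crd t)) => _ E; exact: E. Qed.

Lemma pd_crd (R : realType) n (M : manifold R n) (k i : 'I_n) (p : M) :
  pd (fun q : M => crd q 0 k) i p = (i == k)%:R.
Proof.
by rewrite (@pd_line_crd R n M k i _ p (@smooth_id_line R)) pd_id_line mulr1.
Qed.

Lemma pdC (R : realType) n (M : manifold R n) (f : M -> R) i j (p : M) :
  smooth f -> pd (pd f i) j p = pd (pd f j) i p.
Proof.
move=> sf.
have E k l : pd (pd f k) l p
    = 'D_(delta_mx 0 l) ('D_(delta_mx 0 k) (f \o prm)) (crd p).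
  exact: (@pd_eq_chart _ _ M (pd f k) _ l p (fun=> erefl)).
refine (eq_trans (E i j) _); refine (eq_trans _ (esym (E j i))).
have Up : range (@crd R n M) (crd p) by exists p.
have [_ d2] := sf 2%N.
apply: (@deriveC _ _ _ (f \o prm) _ _ _ (@crd_open _ _ M) Up).
- by move=> y Uy; split; [exact: (d2 i).1|exact: (d2 j).1].
- by move=> y Uy; split; [exact: ((d2 i).2.2 j).1|exact: ((d2 j).2.2 i).1].
- exact: ((d2 i).2.2 j).2.1.
- exact: ((d2 j).2.2 i).2.1.
Qed.

(** * Coordinates on B_R *)

Lemma sum4 (V : nmodType) (F : 'I_4 -> V) :
  \sum_i F i = F 0 + F 1 + F 2 + F 3.
Proof.
rewrite !big_ord_recl big_ord0 addr0 !addrA.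
by do !congr (_ + _); congr F; apply: val_inj.
Qed.

Lemma sum5 (V : nmodType) (F : 'I_5 -> V) :
  \sum_i F i = F 0 + F 1 + F 2 + F 3 + F 4.
Proof.
rewrite !big_ord_recl big_ord0 addr0 !addrA.
by do !congr (_ + _); congr F; apply: val_inj.
Qed.

Lemma sum_lt4 (V : nmodType) (F : 'I_4 -> 'I_4 -> V) :
  \sum_(i < 4) \sum_(j < 4 | (i < j)%N) F i j
  = F 0 1 + F 0 2 + F 0 3 + F 1 2 + F 1 3 + F 2 3.
Proof.
rewrite sum4 !(big_mkcond (fun j : 'I_4 => (_ < j)%N)) /= !sum4 /=.
by rewrite !add0r !addr0 !addrA.
Qed.

Lemma ord4_ind (P : 'I_4 -> Prop) : P 0 -> P 1 -> P 2 -> P 3 -> forall k, P k.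
Proof.
move=> P0 P1 P2 P3 [[|[|[|[|//]]]] lk]; [move: P0|move: P1|move: P2|move: P3];
  by congr P; apply: val_inj.
Qed.

Lemma ord5_ind (P : 'I_5 -> Prop) : P 0 -> P 1 -> P 2 -> P 3 -> P 4 ->
  forall k, P k.
Proof.
move=> P0 P1 P2 P3 P4 [[|[|[|[|[|//]]]]] lk];
  [move: P0|move: P1|move: P2|move: P3|move: P4]; by congr P; apply: val_inj.
Qed.

Lemma mxDE (V : realType) m n (A C : 'M[V]_(m, n)) i j :
  (A + C) i j = A i j + C i j.
Proof. by rewrite mxE. Qed.

Lemma mxNE (V : realType) m n (A : 'M[V]_(m, n)) i j : (- A) i j = - A i j.
Proof. by rewrite mxE. Qed.

Lemma mxZE (R : realType) m n (c : R) (A : 'M[R]_(m, n)) i j :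
  (c *: A) i j = c * A i j.
Proof. by rewrite mxE. Qed.

Lemma mx0E (V : realType) m n i j : (0 : 'M[V]_(m, n)) i j = 0.
Proof. by rewrite mxE. Qed.

Definition mxopE := (mxDE, mxNE, mxZE, mx0E).

Lemma vapp_sum (R : realType) n (M : manifold R n) r (c : 'I_r -> R)
    (e : 'I_r -> 'rV[R]_n) (f : M -> R) p :
  vapp (\sum_k c k *: e k) f p = \sum_k c k * vapp (e k) f p.
Proof.
rewrite /vapp; under [RHS]eq_bigr do rewrite mulr_sumr.
rewrite exchange_big /=; apply: eq_bigr => i _.
by rewrite summxE mulr_suml; apply: eq_bigr => k _; rewrite mxE mulrA.
Qed.

Lemma bivappD (R : realType) n (M : manifold R n) (P Q : 'M[R]_n) (f g : M -> R) p :
  bivapp (P + Q) f g p = bivapp P f g p + bivapp Q f g p.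
Proof.
rewrite -big_split; apply: eq_bigr => i _; rewrite -big_split /=.
by apply: eq_bigr => j _; rewrite mxE !mulrDl.
Qed.

Lemma bivappZ (R : realType) n (M : manifold R n) c (P : 'M[R]_n) (f g : M -> R) p :
  bivapp (c *: P) f g p = c * bivapp P f g p.
Proof.
rewrite /bivapp mulr_sumr; apply: eq_bigr => i _; rewrite mulr_sumr.
by apply: eq_bigr => j _; rewrite mxE !mulrA.
Qed.

Lemma wedgeE (R : realType) n (v w : 'rV[R]_n) i j :
  wedge v w i j = v 0 i * w 0 j - w 0 i * v 0 j.
Proof. by rewrite !mxE !big_ord1 !mxE. Qed.

Lemma bivapp_wedge (R : realType) n (M : manifold R n) (v w : 'rV[R]_n)
    (f g : M -> R) p :
  bivapp (wedge v w) f g p = vapp v f p * vapp w g p - vapp w f p * vapp v g p.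
Proof.
rewrite /vapp !big_distrlr /= -sumrB; apply: eq_bigr => i _.
by rewrite -sumrB; apply: eq_bigr => j _; rewrite wedgeE; ring.
Qed.

(** [ring] and [field] compare atoms up to conversion, which would unfold limits;
partial derivatives and matrix entries are turned into variables first. *)
Ltac gen_pd := repeat match goal with
  |- context [@pd ?R ?n ?M ?f ?i ?p] => generalize (@pd R n M f i p) => ? end.

Ltac gen_mx := repeat match goal with
  |- context [@fun_of_matrix ?T ?m ?n ?A ?i ?j] =>
  generalize (@fun_of_matrix T m n A i j) => ? end.

Section Coordinates.
Variable R : realType.
Implicit Types (p : BR R) (f g : BR R -> R).

Definition cx p : R := crd p 0 0.
Definition ca p : R := crd p 0 1.
Definition cu p : R := crd p 0 2.
Definition cv p : R := crd p 0 3.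
Definition cy p : R := crd p 0 4.

Lemma caE p : ca p = complex.Re (sval p.1.2 0 0). Proof. by rewrite /ca mxE. Qed.
Lemma cuE p : cu p = complex.Re (sval p.1.2 1 0). Proof. by rewrite /cu mxE. Qed.
Lemma cvE p : cv p = complex.Im (sval p.1.2 1 0). Proof. by rewrite /cv mxE. Qed.
Lemma cxE p : cx p = p.1.1. Proof. by rewrite /cx mxE. Qed.
Lemma cyE p : cy p = p.2. Proof. by rewrite /cy mxE. Qed.

Lemma ca_gt0 p : 0 < ca p.
Proof.
rewrite caE; have /and3P[+ _ _] := svalP p.1.2.
by rewrite ltcE => /andP[].
Qed.

Lemma ca_neq0 p : ca p != 0. Proof. by rewrite gt_eqF // ca_gt0. Qed.

Lemma g00E p : sval p.1.2 0 0 = (ca p)%:C%C.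
Proof.
rewrite caE; have /and3P[+ _ _] := svalP p.1.2.
by move=> g0; rewrite RRe_real // realE (ltW g0).
Qed.

Lemma g01E p : sval p.1.2 0 1 = 0.
Proof. by have /and3P[_ /eqP + _] := svalP p.1.2. Qed.

Lemma g11E p : sval p.1.2 1 1 = (ca p)^-1%:C%C.
Proof.
have /and3P[_ _ /eqP ->] := svalP p.1.2.
by rewrite g00E fmorphV.
Qed.

Lemma g10E p : sval p.1.2 1 0 = (cu p +i* cv p)%C.
Proof. by rewrite cuE cvE; case: (sval p.1.2 1 0). Qed.

Definition row5 (x a u v y : R) : 'rV[R]_5 :=
  \row_j nth 0 [:: x; a; u; v; y] j.

Lemma crdE p : crd p = row5 (cx p) (ca p) (cu p) (cv p) (cy p).
Proof. by apply/rowP => k; rewrite [RHS]mxE; elim/ord5_ind: k. Qed.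

Lemma vapp_row5 (x a u v y : R) f p : vapp (row5 x a u v y) f p
  = x * pd f 0 p + a * pd f 1 p + u * pd f 2 p + v * pd f 3 p + y * pd f 4 p.
Proof. by rewrite /vapp sum5 !mxE. Qed.

Lemma BRcrdE (x y : R) (G : 'M[R[i]]_2) :
  BRcrd x G y = row5 x (complex.Re (G 0 0)) (complex.Re (G 1 0))
    (complex.Im (G 1 0)) y.
Proof. by []. Qed.

(** This is - {u, v}. *)
Definition uvcoef p : R := 4^-1 * (cx p * ca p ^+ 2 - cy p * ca p ^- 2).

Lemma pbracketE f g p : pbracket (@PiB R) f g p =
  - (ca p * cv p) * (pd f 1 p * pd g 2 p - pd f 2 p * pd g 1 p)
  + ca p * cu p * (pd f 1 p * pd g 3 p - pd f 3 p * pd g 1 p)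
  - uvcoef p * (pd f 2 p * pd g 3 p - pd f 3 p * pd g 2 p).
Proof.
rewrite /pbracket.
have -> : PiB p = wedge (BRcrd 0 (mx2 0 0 ('i%C * sval p.1.2 1 0) 0) 0)
     (BRcrd 0 (mx2 (- sval p.1.2 0 0) 0 0 (sval p.1.2 0 0)^-1) 0)
  + uvcoef p *: wedge (BRcrd 0 (mx2 0 0 'i%C 0) 0) (BRcrd 0 (mx2 0 0 1 0) 0).
  by rewrite /uvcoef cxE caE cyE; case: p => [[x h] y].
rewrite bivappD bivappZ !bivapp_wedge !BRcrdE !vapp_row5 !mxE /=.
rewrite g00E g10E /=; gen_pd; ring.
Qed.

Lemma half_complexE : (2^-1 : R[i]) = (2^-1)%:C%C.
Proof. by rewrite fmorphV /= rmorph_nat. Qed.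

Lemma frameE (i : 'I_4) p : BR_frame i p = nth 0
  [:: row5 0 0 0 0 2;
      row5 0 (- (2^-1 * ca p)) (- (2^-1 * cu p)) (- (2^-1 * cv p)) 0;
      row5 0 0 0 (2^-1 * (ca p)^-1) 0; row5 0 0 (2^-1 * (ca p)^-1) 0 0] i.
Proof.
rewrite /BR_frame; apply/rowP => k.
elim/ord4_ind: i => /=; rewrite [RHS]mxE [LHS]mxE ?mul2E !mxE /=;
  rewrite ?(g00E p) ?(g01E p) ?(g10E p) ?(g11E p) ?half_complexE /=;
  elim/ord5_ind: k => //=; ring.
Qed.

Definition frame_act p f (k : nat) : R := nth 0
  [:: 2 * pd f 4 p;
      - (2^-1 * (ca p * pd f 1 p + cu p * pd f 2 p + cv p * pd f 3 p));
      2^-1 * (ca p)^-1 * pd f 3 p;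
      2^-1 * (ca p)^-1 * pd f 2 p] k.

Lemma vapp_frame (i : 'I_4) f p : vapp (BR_frame i p) f p = frame_act p f i.
Proof.
rewrite frameE.
by elim/ord4_ind: i; rewrite /frame_act /= vapp_row5; gen_pd; ring.
Qed.

Definition linv_act (X : line R -> 'rV[R]_4) f : BR R -> R := fun q =>
  vapp (linv (BR_groupoid R) (@BR_frame R) X q) f q.

Lemma linv_actE X f p : linv_act X f p = X (cy p) 0 0 * (2 * pd f 4 p)
  - X (cy p) 0 1 * (2^-1 * (ca p * pd f 1 p + cu p * pd f 2 p + cv p * pd f 3 p))
  + X (cy p) 0 2 * (2^-1 * (ca p)^-1 * pd f 3 p)
  + X (cy p) 0 3 * (2^-1 * (ca p)^-1 * pd f 2 p).
Proof.
rewrite /linv_act /linv vapp_sum; under eq_bigr => k _ do rewrite vapp_frame.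
by rewrite sum4 /frame_act /= mulrN cyE.
Qed.

End Coordinates.

(** * Computation of partial derivatives *)

(** Rewriting by generalization only looks for syntactic occurrences of the left
side; unification would compare partial derivatives by unfolding them. *)
Ltac rw_closed H :=
  lazymatch type of H with ?l = ?r => move: H; generalize l; intros ? -> end.

Section Calculus.
Variable R : realType.
Implicit Types (p : BR R) (f g h : BR R -> R).

Lemma smooth_cx : smooth (@cx R). Proof. exact: smooth_crd. Qed.
Lemma smooth_ca : smooth (@ca R). Proof. exact: smooth_crd. Qed.
Lemma smooth_cu : smooth (@cu R). Proof. exact: smooth_crd. Qed.
Lemma smooth_cv : smooth (@cv R). Proof. exact: smooth_crd. Qed.
Lemma smooth_cy : smooth (@cy R). Proof. exact: smooth_crd. Qed.

Lemma smooth_caV : smooth (fun p => (ca p)^-1).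
Proof. by apply: smoothV smooth_ca; exact: ca_neq0. Qed.

Lemma smooth_secT (X : line R -> 'rV[R]_4) k : smoothv X ->
  smooth (fun p => X (cy p) 0 k).
Proof.
by move=> sX; exact: (@smooth_line_crd R 5 (BR R) 4 (fun y => X y 0 k) (sX k)).
Qed.

Lemma pd_cx i p : pd (@cx R) i p = (i == 0)%:R. Proof. exact: pd_crd. Qed.
Lemma pd_ca i p : pd (@ca R) i p = (i == 1)%:R. Proof. exact: pd_crd. Qed.
Lemma pd_cu i p : pd (@cu R) i p = (i == 2)%:R. Proof. exact: pd_crd. Qed.
Lemma pd_cv i p : pd (@cv R) i p = (i == 3)%:R. Proof. exact: pd_crd. Qed.
Lemma pd_cy i p : pd (@cy R) i p = (i == 4)%:R. Proof. exact: pd_crd. Qed.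

Lemma pd_caV i p : pd (fun q => (ca q)^-1) i p = - ((i == 1)%:R / ca p ^+ 2).
Proof. by rewrite pdV ?pd_ca //; [exact: ca_neq0|exact: smooth_ca]. Qed.

Lemma pd_secT (X : line R -> 'rV[R]_4) k i p : smoothv X ->
  pd (fun q => X (cy q) 0 k) i p = (i == 4)%:R * pd (fun y => X y 0 k) 0 (cy p).
Proof.
move=> sX.
exact: (@pd_line_crd R 5 (BR R) 4 i (fun y => X y 0 k) p (sX k)).
Qed.

End Calculus.

Ltac smooth_tac := cbv beta; lazymatch goal with
| |- @smooth _ _ ?M (fun q => @?f q + @?g q) =>
    apply: (@smoothD _ _ M f g); smooth_tac
| |- @smooth _ _ ?M (fun q => @?f q * @?g q) =>
    apply: (@smoothM _ _ M f g); smooth_tac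
| |- @smooth _ _ ?M (fun q => - @?f q) => apply: (@smoothN _ _ M f); smooth_tac
| |- @smooth _ _ ?M (fun q => (ca q)^-1) => exact: smooth_caV
| |- @smooth _ _ ?M (fun q => fun_of_matrix (?X (cy q)) _ ?k) =>
    apply: smooth_secT; assumption
| H : smoothv ?X |- @smooth _ _ ?M (fun q => fun_of_matrix (?X q) _ ?k) =>
    exact: (H k)
| |- @smooth _ _ ?M (fun q => q) => exact: smooth_id_line
| |- @smooth _ _ ?M (fun q => ?f q) => change (@smooth _ _ M f); smooth_tac
| |- @smooth _ _ ?M (fun _ => ?c) => exact: (@smooth_cst _ _ M c)
| |- smooth (@cx _) => exact: smooth_cx
| |- smooth (@ca _) => exact: smooth_ca
| |- smooth (@cu _) => exact: smooth_cu
| |- smooth (@cv _) => exact: smooth_cv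
| |- smooth (@cy _) => exact: smooth_cy
| |- @smooth _ _ ?M (pd ?f ?i) => apply: (@smooth_pd _ _ M f i); smooth_tac
| H : forall l, smooth (?x l) |- smooth (?x ?l) => exact: H
| |- smooth ?f => assumption
end.

Lemma pdD_eq (R : realType) n (M : manifold R n) (f g : M -> R) i (p : M) a b :
  smooth f -> smooth g -> pd f i p = a -> pd g i p = b ->
  pd (fun q => f q + g q) i p = a + b.
Proof. by move=> sf sg <- <-; exact: pdD. Qed.

Lemma pdM_eq (R : realType) n (M : manifold R n) (f g : M -> R) i (p : M) a b :
  smooth f -> smooth g -> pd f i p = a -> pd g i p = b ->
  pd (fun q => f q * g q) i p = a * g p + f p * b.
Proof. by move=> sf sg <- <-; exact: pdM. Qed.

Lemma pdN_eq (R : realType) n (M : manifold R n) (f : M -> R) i (p : M) a :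
  smooth f -> pd f i p = a -> pd (fun q => - f q) i p = - a.
Proof. by move=> sf <-; exact: pdN. Qed.

(** The right side is an existential variable, to be filled with the derivative
computed from the shape of the function. Derivatives of unknown smooth functions
are left as they are. *)
Ltac pd_tac := cbv beta; lazymatch goal with
| |- @pd _ _ ?M (fun q => @?f q + @?g q) ?i ?p = _ =>
    eapply (@pdD_eq _ _ M f g i p); [smooth_tac|smooth_tac|pd_tac|pd_tac]
| |- @pd _ _ ?M (fun q => @?f q * @?g q) ?i ?p = _ =>
    eapply (@pdM_eq _ _ M f g i p); [smooth_tac|smooth_tac|pd_tac|pd_tac]
| |- @pd _ _ ?M (fun q => - @?f q) ?i ?p = _ =>
    eapply (@pdN_eq _ _ M f i p); [smooth_tac|pd_tac]
| |- @pd _ _ ?M (fun q => (ca q)^-1) ?i ?p = _ => eapply pd_caV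
| |- @pd _ _ ?M (fun q => fun_of_matrix (?X (cy q)) _ ?k) ?i ?p = _ =>
   eapply pd_secT; assumption
| |- @pd _ _ ?M (fun q => q) _ ?p = _ => eapply pd_id_line
| |- @pd _ _ ?M (fun q => ?f q) ?i ?p = ?r => change (@pd _ _ M f i p = r); pd_tac
| |- @pd _ _ ?M (fun _ => ?c) ?i ?p = _ => eapply pd_cst
| |- @pd _ _ ?M (@cx _) ?i ?p = _ => eapply pd_cx
| |- @pd _ _ ?M (@ca _) ?i ?p = _ => eapply pd_ca
| |- @pd _ _ ?M (@cu _) ?i ?p = _ => eapply pd_cu
| |- @pd _ _ ?M (@cv _) ?i ?p = _ => eapply pd_cv
| |- @pd _ _ ?M (@cy _) ?i ?p = _ => eapply pd_cy
| H : pd ?f ?i ?p = _ |- pd ?f ?i ?p = _ => eapply H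
| H : forall i p, pd ?f i p = @?r i p |- pd ?f ?i ?p = _ => eapply H
| H : forall l i p, pd (?x l) i p = _ |- pd (?x ?l) ?i ?p = _ => eapply H
| |- pd ?f ?i ?p = _ => reflexivity
end.

Ltac pd_expand := repeat match goal with |- context [@pd ?R ?n ?M ?F ?i ?p] =>
  assert_fails (is_var F);
  lazymatch F with
  | pd _ _ => fail
  | (fun q => fun_of_matrix (?X q) _ _) => fail
  | _ => idtac end;
  let H := fresh in
  eassert (H : @pd R n M F i p = _) by pd_tac; cbv beta in H;
  lazymatch type of H with ?l = ?l => fail | _ => rw_closed H end end.

Section Calculus.
Variable R : realType.
Implicit Types (p : BR R) (f g h : BR R -> R).

Lemma uvcoefE : @uvcoef R = fun p =>
  4^-1 * (cx p * (ca p * ca p) - cy p * ((ca p)^-1 * (ca p)^-1)).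
Proof. by apply/funext => p; rewrite /uvcoef expr2 invfM. Qed.

Lemma smooth_uvcoef : smooth (@uvcoef R).
Proof. by rewrite uvcoefE; smooth_tac. Qed.

Lemma pd_uvcoef i p : pd (@uvcoef R) i p =
  4^-1 * ((i == 0)%:R * ca p ^+ 2 - (i == 4)%:R / ca p ^+ 2)
  + 2^-1 * (i == 1)%:R * (cx p * ca p + cy p / ca p ^+ 3).
Proof.
rewrite uvcoefE; pd_expand; have := ca_neq0 p.
by move: (ca p) (cx p) (cy p) => a x y a0; field.
Qed.

End Calculus.

(** * The Jacobi identity *)

(** Second derivatives with increasing indices, for [field] to recognize equal
ones. *)
Ltac pd_swap sf p :=
  lazymatch type of sf with smooth ?f =>
    rw_closed (@pdC _ _ _ f 2 1 p sf); rw_closed (@pdC _ _ _ f 3 1 p sf);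
    rw_closed (@pdC _ _ _ f 3 2 p sf); rw_closed (@pdC _ _ _ f 4 1 p sf);
    rw_closed (@pdC _ _ _ f 4 2 p sf); rw_closed (@pdC _ _ _ f 4 3 p sf) end.

Section Poisson.
Variable R : realType.
Implicit Types (p : BR R) (f g h : BR R -> R).

(** The direction [i] is arbitrary, so that one rule serves all the derivatives
that occur in iterated brackets. *)
Lemma pd_bracket f g i p : smooth f -> smooth g ->
  pd (pbracket (@PiB R) f g) i p =
  - ((i == 1)%:R * cv p + ca p * (i == 3)%:R)
    * (pd f 1 p * pd g 2 p - pd f 2 p * pd g 1 p)
  - ca p * cv p * (pd (pd f 1) i p * pd g 2 p + pd f 1 p * pd (pd g 2) i p
                 - pd (pd f 2) i p * pd g 1 p - pd f 2 p * pd (pd g 1) i p)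
  + ((i == 1)%:R * cu p + ca p * (i == 2)%:R)
    * (pd f 1 p * pd g 3 p - pd f 3 p * pd g 1 p)
  + ca p * cu p * (pd (pd f 1) i p * pd g 3 p + pd f 1 p * pd (pd g 3) i p
                 - pd (pd f 3) i p * pd g 1 p - pd f 3 p * pd (pd g 1) i p)
  - pd (@uvcoef R) i p * (pd f 2 p * pd g 3 p - pd f 3 p * pd g 2 p)
  - uvcoef p * (pd (pd f 2) i p * pd g 3 p + pd f 2 p * pd (pd g 3) i p
          - pd (pd f 3) i p * pd g 2 p - pd f 3 p * pd (pd g 2) i p).
Proof.
move=> sf sg; have scc := @smooth_uvcoef R.
have -> : pbracket (@PiB R) f g = fun q =>
  - (ca q * cv q) * (pd f 1 q * pd g 2 q - pd f 2 q * pd g 1 q)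
  + ca q * cu q * (pd f 1 q * pd g 3 q - pd f 3 q * pd g 1 q)
  - uvcoef q * (pd f 2 q * pd g 3 q - pd f 3 q * pd g 2 q).
  by apply/funext => q; rewrite pbracketE.
by pd_expand; gen_pd; ring.
Qed.

Lemma smooth_bracket f g : smooth f -> smooth g ->
  smooth (pbracket (@PiB R) f g).
Proof.
move=> sf sg; have scc := @smooth_uvcoef R.
rewrite (_ : pbracket _ _ _ = fun q =>
  - (ca q * cv q) * (pd f 1 q * pd g 2 q - pd f 2 q * pd g 1 q)
  + ca q * cu q * (pd f 1 q * pd g 3 q - pd f 3 q * pd g 1 q)
  - uvcoef q * (pd f 2 q * pd g 3 q - pd f 3 q * pd g 2 q)); first by smooth_tac.
by apply/funext => q; rewrite pbracketE.
Qed.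

Lemma pd_linv_act X f i p : smoothv X -> smooth f -> pd (linv_act X f) i p =
  (i == 4)%:R * pd (fun y : line R => X y 0 0) 0 (cy p) * (2 * pd f 4 p)
  + X (cy p) 0 0 * (2 * pd (pd f 4) i p)
  - (i == 4)%:R * pd (fun y : line R => X y 0 1) 0 (cy p)
    * (2^-1 * (ca p * pd f 1 p + cu p * pd f 2 p + cv p * pd f 3 p))
  - X (cy p) 0 1 * (2^-1 * ((i == 1)%:R * pd f 1 p + (i == 2)%:R * pd f 2 p
      + (i == 3)%:R * pd f 3 p + ca p * pd (pd f 1) i p
      + cu p * pd (pd f 2) i p + cv p * pd (pd f 3) i p))
  + (i == 4)%:R * pd (fun y : line R => X y 0 2) 0 (cy p)
    * (2^-1 * (ca p)^-1 * pd f 3 p)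
  + X (cy p) 0 2 * (2^-1 * (- ((i == 1)%:R / ca p ^+ 2) * pd f 3 p
      + (ca p)^-1 * pd (pd f 3) i p))
  + (i == 4)%:R * pd (fun y : line R => X y 0 3) 0 (cy p)
    * (2^-1 * (ca p)^-1 * pd f 2 p)
  + X (cy p) 0 3 * (2^-1 * (- ((i == 1)%:R / ca p ^+ 2) * pd f 2 p
      + (ca p)^-1 * pd (pd f 2) i p)).
Proof.
move=> sX sf.
have -> : linv_act X f = fun p => X (cy p) 0 0 * (2 * pd f 4 p)
  - X (cy p) 0 1 * (2^-1 * (ca p * pd f 1 p + cu p * pd f 2 p + cv p * pd f 3 p))
  + X (cy p) 0 2 * (2^-1 * (ca p)^-1 * pd f 3 p)
  + X (cy p) 0 3 * (2^-1 * (ca p)^-1 * pd f 2 p).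
  by apply/funext => q; rewrite linv_actE.
by pd_expand; rewrite /=; gen_pd; ring.
Qed.

(** The second derivatives of [f], [g] and [h] cancel by symmetry; the rest is
the Jacobi identity for the coordinates a, u, v. *)
Lemma PiB_jacobi f g h p : smooth f -> smooth g -> smooth h ->
  pbracket (@PiB R) f (pbracket (@PiB R) g h) p
  + pbracket (@PiB R) g (pbracket (@PiB R) h f) p
  + pbracket (@PiB R) h (pbracket (@PiB R) f g) p = 0.
Proof.
move=> sf sg sh; rewrite !pbracketE !pd_bracket // !pd_uvcoef /=.
pd_swap sf p; pd_swap sg p; pd_swap sh p.
have := ca_neq0 p; gen_pd.
move: (uvcoef p) (cx p) (ca p) (cu p) (cv p) (cy p) => c x a u v y a0.
by field.
Qed.

End Poisson.

(** * The two Lie algebroids *)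

Section Algebroids.
Variable R : realType.
Implicit Types (X Y : line R -> 'rV[R]_4) (f : line R -> R) (y : line R).

Lemma BR_anchor_act X f y :
  anchor_act (anchor (BR_algebroid R)) X f y = 2 * X y 0 0 * pd f 0 y.
Proof.
rewrite /anchor_act /vapp big_ord1 /= mxE sum4 !mxE /=.
by rewrite !mulr0 !addr0 (mulrC 2).
Qed.

Lemma AR_anchor_act X f y : anchor_act (anchor (AR_algebroid R)) X f y = 0.
Proof. by rewrite /anchor_act /vapp big_ord1 /= mulmx0 mxE mul0r. Qed.

Definition BR_bracket_seq X Y y : seq R :=
  [:: 2 * X y 0 0 * pd (fun z : line R => Y z 0 0) 0 y
      - 2 * Y y 0 0 * pd (fun z : line R => X z 0 0) 0 y;
      2 * X y 0 0 * pd (fun z : line R => Y z 0 1) 0 y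
      - 2 * Y y 0 0 * pd (fun z : line R => X z 0 1) 0 y;
      X y 0 1 * Y y 0 2 - X y 0 2 * Y y 0 1
      + (2 * X y 0 0 * pd (fun z : line R => Y z 0 2) 0 y
         - 2 * Y y 0 0 * pd (fun z : line R => X z 0 2) 0 y);
      X y 0 1 * Y y 0 3 - X y 0 3 * Y y 0 1
      + (2 * X y 0 0 * pd (fun z : line R => Y z 0 3) 0 y
         - 2 * Y y 0 0 * pd (fun z : line R => X z 0 3) 0 y)].

(** Unlike [abr (BR_algebroid R)], this form of the bracket is not unfolded to a
double sum by simplification. *)
Definition BR_bracket X Y : line R -> 'rV[R]_4 :=
  fun y => \row_k nth 0 (BR_bracket_seq X Y y) k.

Lemma BR_abr X Y : abr (BR_algebroid R) X Y = BR_bracket X Y.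
Proof.
apply/funext => y; apply/rowP => k; rewrite [RHS]mxE.
rewrite /abr /BR_algebroid /frame_algebroid mxE [X in _ + X]mxE.
rewrite -[X in anchor_act X]/(anchor (BR_algebroid R)) !BR_anchor_act.
rewrite sum4 !(sum4 (fun j => (X y 0 _ * Y y 0 j) *: _)) /=.
rewrite !scaler0 !addr0 !add0r !mxE.
by elim/ord4_ind: k; rewrite /BR_bracket_seq /=; gen_pd; gen_mx; ring.
Qed.

Definition AR_bracket X Y : line R -> 'rV[R]_4 := fun y => \row_k nth 0
  [:: 2 * (X y 0 2 * Y y 0 3 - X y 0 3 * Y y 0 2);
      2 * y * (X y 0 2 * Y y 0 3 - X y 0 3 * Y y 0 2);
      2 * (X y 0 3 * Y y 0 1 - X y 0 1 * Y y 0 3);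
      2 * (X y 0 1 * Y y 0 2 - X y 0 2 * Y y 0 1)] k.

Lemma AR_abr X Y : abr (AR_algebroid R) X Y = AR_bracket X Y.
Proof.
apply/funext => y; apply/rowP => k; rewrite [RHS]mxE.
rewrite /abr /AR_algebroid /frame_algebroid mxE [X in _ + X]mxE.
rewrite -[X in anchor_act X]/(anchor (AR_algebroid R)) !AR_anchor_act.
rewrite sum4 !(sum4 (fun j => (X y 0 _ * Y y 0 j) *: _)) /=.
rewrite !scaler0 !addr0 !add0r !mxE.
by elim/ord4_ind: k => /=; gen_mx; ring.
Qed.

Lemma BR_bracketE X Y k :
  (fun y => BR_bracket X Y y 0 k) = fun y => nth 0 (BR_bracket_seq X Y y) k.
Proof. by apply/funext => y; rewrite mxE. Qed.

End Algebroids.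

Ltac BR_bracket_expand := repeat match goal with
| |- context [fun_of_matrix (BR_bracket ?X ?Y ?y) _ ?k] =>
   let H := fresh in have H := congr1 (fun h => h y) (BR_bracketE X Y k);
   cbv beta in H; rw_closed H; rewrite /BR_bracket_seq /=
| |- context [@pd ?R ?n ?M ?F ?i ?y] =>
   lazymatch F with (fun z => fun_of_matrix (BR_bracket ?X ?Y z) _ ?k) =>
   let H := fresh in
   have H := congr1 (fun h => @pd R n M h i y) (BR_bracketE X Y k);
   cbv beta in H;
   lazymatch type of H with _ = ?r => change (@pd R n M F i y = r) in H end;
   rw_closed H; rewrite /BR_bracket_seq /= end
end.

Section Algebroids.
Variable R : realType.
Implicit Types (X Y : line R -> 'rV[R]_4) (f : line R -> R) (y : line R).

Lemma BR_lie_algebroid : lie_algebroid (BR_algebroid R).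
Proof.
split=> [i j|X Y Z sX sY sZ].
  by rewrite (_ : (fun p => _) = fun=> if i == 0 then 2 else 0);
    [exact: smooth_cst|apply/funext => y; rewrite mxE].
rewrite !BR_abr; split=> [k|y|y|y|f sf y].
- rewrite BR_bracketE /BR_bracket_seq -/(smooth _).
  by elim/ord4_ind: k => /=; smooth_tac.
- have E l : (fun y => (Y y + Z y) 0 l) = fun y => Y y 0 l + Z y 0 l.
    by apply/funext => z; rewrite mxE.
  apply/rowP => k; rewrite mxDE.
  elim/ord4_ind: k; BR_bracket_expand; rewrite !E !mxDE; pd_expand;
    by rewrite /=; gen_pd; gen_mx; ring.
- apply/rowP => k; rewrite mxNE.
  by elim/ord4_ind: k; BR_bracket_expand; rewrite /=; gen_pd; gen_mx; ring.
- apply/rowP => k; rewrite !mxDE mx0E.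
  elim/ord4_ind: k; BR_bracket_expand; pd_expand;
    by rewrite /=; gen_pd; gen_mx; ring.
- have E l : (fun y => (f y *: Y y) 0 l) = fun y => f y * Y y 0 l.
    by apply/funext => z; rewrite mxE.
  rewrite BR_abr BR_anchor_act; apply/rowP => k; rewrite mxDE !mxZE.
  elim/ord4_ind: k; BR_bracket_expand; rewrite !E !mxZE; pd_expand;
    by rewrite /=; gen_pd; gen_mx; ring.
Qed.

End Algebroids.

(** * The Lie bialgebroid *)

Section Bialgebroid.
Variable R : realType.
Implicit Types (X Y : line R -> 'rV[R]_4) (f : line R -> R) (y : line R).
Let e (a : 'I_4) : 'rV[R]_4 := delta_mx 0 a.

Lemma AR_lie_algebroid : lie_algebroid (AR_algebroid R).
Proof.
split=> [i j|X Y Z sX sY sZ].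
  by rewrite (_ : (fun p => _) = fun=> 0);
    [exact: smooth_cst|apply/funext => y; rewrite mxE].
rewrite !AR_abr; split=> [k|y|y|y|f sf y].
- rewrite (_ : (fun p => _) = fun y => nth 0
    [:: 2 * (X y 0 2 * Y y 0 3 - X y 0 3 * Y y 0 2);
      2 * y * (X y 0 2 * Y y 0 3 - X y 0 3 * Y y 0 2);
      2 * (X y 0 3 * Y y 0 1 - X y 0 1 * Y y 0 3);
      2 * (X y 0 1 * Y y 0 2 - X y 0 2 * Y y 0 1)] k).
    by rewrite -/(smooth _); elim/ord4_ind: k => /=; smooth_tac.
  by apply/funext => y; rewrite mxE.
- by apply/rowP => k; rewrite mxDE !mxE; elim/ord4_ind: k => /=; gen_mx; ring.
- by apply/rowP => k; rewrite mxNE !mxE; elim/ord4_ind: k => /=; gen_mx; ring.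
- apply/rowP => k; rewrite !mxDE !mxE.
  by elim/ord4_ind: k => /=; rewrite ?mxE /=; gen_mx; ring.
- rewrite AR_abr AR_anchor_act scale0r addr0.
  by apply/rowP => k; rewrite mxZE !mxE; elim/ord4_ind: k => /=; gen_mx; ring.
Qed.

Lemma delta_fun_AR f : delta_fun (AR_algebroid R) f = fun=> 0.
Proof.
by apply/funext => y; apply/rowP => k; rewrite !mxE AR_anchor_act oppr0.
Qed.

Lemma delta_mx2_AR X : delta_mx2 (AR_algebroid R) X = fun y =>
  (2 * X y 0 3) *: wedge (e 1) (e 2) + (- (2 * X y 0 2)) *: wedge (e 1) (e 3)
  + (2 * y * X y 0 1 + 2 * X y 0 0) *: wedge (e 2) (e 3).
Proof.
apply/funext => y; apply/matrixP => i j; rewrite !mxDE !mxZE !wedgeE.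
rewrite [LHS]mxE /delta !AR_anchor_act subr0 addr0 AR_abr /pairing sum4 !mxE /=.
elim/ord4_ind: i; elim/ord4_ind: j => /=; gen_mx; ring.
Qed.

Lemma delta_mx2_ARE X y i j : delta_mx2 (AR_algebroid R) X y i j =
  2 * X y 0 3 * ((i == 1)%:R * (j == 2)%:R - (i == 2)%:R * (j == 1)%:R)
  - 2 * X y 0 2 * ((i == 1)%:R * (j == 3)%:R - (i == 3)%:R * (j == 1)%:R)
  + (2 * y * X y 0 1 + 2 * X y 0 0)
    * ((i == 2)%:R * (j == 3)%:R - (i == 3)%:R * (j == 2)%:R).
Proof. by rewrite delta_mx2_AR 2!mxDE 3!mxZE !wedgeE !mxE /= mulNr. Qed.

Lemma smooth_delta_coef X : smoothv X ->
  [/\ smooth (fun y => 2 * X y 0 3), smooth (fun y => - (2 * X y 0 2))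
    & smooth (fun y : line R => 2 * (y : R) * X y 0 1 + 2 * X y 0 0)].
Proof. by move=> sX; split; smooth_tac. Qed.

Lemma BR_bracket_frame X (a : 'I_4) y : BR_bracket X (@frame R 1 (line R) 4 a) y =
  (a == 1)%:R *: (- X y 0 2 *: e 2 - X y 0 3 *: e 3)
  + (a == 2)%:R *: (X y 0 1 *: e 2) + (a == 3)%:R *: (X y 0 1 *: e 3)
  - (a == 0)%:R *: \row_k (2 * pd (fun z : line R => X z 0 k) 0 y).
Proof.
have E k : pd (fun z => @frame R 1 (line R) 4 a z 0 k) 0 y = 0.
  exact: pd_cst.
apply/rowP => k; rewrite !mxDE !mxNE !mxZE !mxDE !mxZE !mxNE !mxZE [LHS]mxE.
rewrite /BR_bracket_seq !E.
rewrite !mxE.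
elim/ord4_ind: k; elim/ord4_ind: a {E} => /=; gen_pd; gen_mx; ring.
Qed.

(** Only [e 0] has a bracket with [X] that contains derivatives of [X], and it
does not occur here: nothing but the coefficients is differentiated. *)
Lemma gerst_wedge X (c12 c13 c23 : line R -> R) y :
  smooth c12 -> smooth c13 -> smooth c23 ->
  gerst (BR_algebroid R) X (fun z => c12 z *: wedge (e 1) (e 2)
    + c13 z *: wedge (e 1) (e 3) + c23 z *: wedge (e 2) (e 3)) y =
  (2 * X y 0 0 * pd c12 0 y + X y 0 1 * c12 y) *: wedge (e 1) (e 2)
  + (2 * X y 0 0 * pd c13 0 y + X y 0 1 * c13 y) *: wedge (e 1) (e 3)
  + (2 * X y 0 0 * pd c23 0 y + 2 * X y 0 1 * c23 y
     + X y 0 3 * c12 y - X y 0 2 * c13 y) *: wedge (e 2) (e 3).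
Proof.
move=> s12 s13 s23.
have E i j : (fun z => (c12 z *: wedge (e 1) (e 2) + c13 z *: wedge (e 1) (e 3)
     + c23 z *: wedge (e 2) (e 3)) i j) = fun z => c12 z * wedge (e 1) (e 2) i j
    + c13 z * wedge (e 1) (e 3) i j + c23 z * wedge (e 2) (e 3) i j.
  by apply/funext => z; rewrite 2!mxDE 3!mxZE.
rewrite /gerst sum_lt4 !BR_anchor_act !E !BR_abr !BR_bracket_frame.
have W a b i j : wedge (e a) (e b) i j
    = (i == a)%:R * (j == b)%:R - (i == b)%:R * (j == a)%:R.
  by rewrite wedgeE !mxE.
have Q i j : (c12 y *: wedge (e 1) (e 2) + c13 y *: wedge (e 1) (e 3)
     + c23 y *: wedge (e 2) (e 3)) i j = c12 y * wedge (e 1) (e 2) i j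
    + c13 y * wedge (e 1) (e 3) i j + c23 y * wedge (e 2) (e 3) i j.
  by rewrite 2!mxDE 3!mxZE.
rewrite !Q !W /=; pd_expand.
rewrite !(mul0r, mulr0, mul1r, mulr1, subr0, sub0r, oppr0, scale0r, scale1r,
  addr0, add0r).
rewrite /wedge. apply/matrixP => i j; rewrite !mxE !big_ord1 !mxE /=.
gen_pd; gen_mx; ring.
Qed.

Lemma BR_lie_bialgebroid : lie_bialgebroid (BR_algebroid R) (AR_algebroid R).
Proof.
split; [exact: BR_lie_algebroid|exact: AR_lie_algebroid|move=> X Y sX sY y].
have [X12 X13 X23] := smooth_delta_coef sX.
have [Y12 Y13 Y23] := smooth_delta_coef sY.
rewrite !delta_mx2_AR !gerst_wedge // BR_abr.
BR_bracket_expand; pd_expand; rewrite /=.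
move: (wedge (e 1) (e 2)) (wedge (e 1) (e 3)) (wedge (e 2) (e 3)) => P Q S.
apply/matrixP => i j; rewrite !mxopE; gen_pd; gen_mx; ring.
Qed.

End Bialgebroid.

(** * Brackets with left-invariant vector fields *)

Section BialgebroidOf.
Variable R : realType.
Implicit Types (X Y : line R -> 'rV[R]_4) (p : BR R) (f g : BR R -> R).

Lemma linv_act_commutator X Y f p : smoothv X -> smoothv Y -> smooth f ->
  linv_act (abr (BR_algebroid R) X Y) f p
  = linv_act X (linv_act Y f) p - linv_act Y (linv_act X f) p.
Proof.
move=> sX sY sf; rewrite BR_abr (linv_actE X (linv_act Y f)).
rewrite (linv_actE Y (linv_act X f)) linv_actE.
BR_bracket_expand; rewrite !pd_linv_act //=; pd_swap sf p.
have := ca_neq0 p; gen_pd; gen_mx.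
by move: (ca p) (cu p) (cv p) => a u v; intros; field.
Qed.

Lemma bivapp_sum n (M : manifold R n) I (r : seq I) (P : pred I)
    (F : I -> 'M[R]_n) (f g : M -> R) (p : M) :
  bivapp (\sum_(i <- r | P i) F i) f g p = \sum_(i <- r | P i) bivapp (F i) f g p.
Proof.
elim/big_rec2: _ => [|i y1 y2 _ <-]; last by rewrite bivappD.
by rewrite /bivapp big1 // => i _; rewrite big1 // => j _; rewrite mxE !mul0r.
Qed.

Lemma bivapp_linv2 (Q : line R -> 'M[R]_4) f g p :
  bivapp (linv2 (BR_groupoid R) (@BR_frame R) Q p) f g p
  = \sum_(i < 4) \sum_(j < 4 | (i < j)%N) Q (cy p) i j
     * (frame_act p f i * frame_act p g j - frame_act p f j * frame_act p g i).
Proof.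
rewrite /linv2 bivapp_sum; apply: eq_bigr => i _.
rewrite bivapp_sum; apply: eq_bigr => j _.
by rewrite bivappZ bivapp_wedge !vapp_frame cyE.
Qed.

(** The right side is a derivation in [f] and in [g], as the second derivatives
cancel by symmetry; both sides then have the same coefficients. *)
Lemma delta_bracket X f g p : smoothv X -> smooth f -> smooth g ->
  bivapp (linv2 (BR_groupoid R) (@BR_frame R) (delta_mx2 (AR_algebroid R) X) p)
    f g p
  = pbracket (@PiB R) (linv_act X f) g p + pbracket (@PiB R) f (linv_act X g) p
    - linv_act X (pbracket (@PiB R) f g) p.
Proof.
move=> sX sf sg.
rewrite bivapp_linv2 sum_lt4 !delta_mx2_ARE /frame_act /=.
rewrite (linv_actE X (pbracket (@PiB R) f g)) !pbracketE !pd_linv_act //.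
rewrite !pd_bracket // !pd_uvcoef /=.
pd_swap sf p; pd_swap sg p.
rewrite /uvcoef.
have := ca_neq0 p; gen_pd; gen_mx.
by move: (cx p) (ca p) (cu p) (cv p) (cy p) => x a u v y; intros; field.
Qed.

End BialgebroidOf.

(** * The Lie groupoid B_R *)

Section Groupoid.
Variable R : realType.
Implicit Types (p q g h : BR R).

Lemma cx_mul p q : cx (gmul (BR_groupoid R) p q) = cx p.
Proof. by rewrite !cxE. Qed.

Lemma cy_mul p q : cy (gmul (BR_groupoid R) p q) = cy q.
Proof. by rewrite !cyE. Qed.

Lemma ca_mul p q : ca (gmul (BR_groupoid R) p q) = ca p * ca q.
Proof. by rewrite caE /= mul2E g01E mul0r addr0 !g00E /= mul0r subr0. Qed.

Lemma cu_mul p q :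
  cu (gmul (BR_groupoid R) p q) = cu p * ca q + (ca p)^-1 * cu q.
Proof. by rewrite cuE /= mul2E g00E g11E !g10E /=; ring. Qed.

Lemma cv_mul p q :
  cv (gmul (BR_groupoid R) p q) = cv p * ca q + (ca p)^-1 * cv q.
Proof. by rewrite cvE /= mul2E g00E g11E !g10E /=; ring. Qed.

Lemma crd_mul p q : crd (gmul (BR_groupoid R) p q) = row5 (cx p) (ca p * ca q)
  (cu p * ca q + (ca p)^-1 * cu q) (cv p * ca q + (ca p)^-1 * cv q) (cy q).
Proof. by rewrite crdE cx_mul cy_mul ca_mul cu_mul cv_mul. Qed.

Lemma crd_one (y : line R) : crd (gone (BR_groupoid R) y) = row5 y 1 0 0 y.
Proof.
by rewrite crdE cxE caE cuE cvE cyE /= !mxE /=.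
Qed.

Lemma mulVB (b : B R) : mulB (invB b) b = oneB R.
Proof.
apply: val_inj => /=; have bB := svalP b; rewrite (invBE bB).
case/and3P: bB => b0 /eqP b01 /eqP b11; have bN := lt0r_neq0 b0.
apply: mx2P; rewrite !mul2E !mxE /= b01 b11 !mulr0 !mul0r !addr0 !add0r.
by rewrite mulVf // mulfV // mulNr (mulrC (sval b 1 0)) addNr.
Qed.

Lemma mulBV (b : B R) : mulB b (invB b) = oneB R.
Proof.
by apply: val_inj => /=; apply: mulmx1C; exact: (congr1 sval (mulVB b)).
Qed.

Lemma crd_inv p : crd (ginv (BR_groupoid R) p)
  = row5 (cy p) (ca p)^-1 (- cu p) (- cv p) (cx p).
Proof.
rewrite crdE; congr row5; rewrite ?caE ?cuE ?cvE ?cxE ?cyE //=;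
  rewrite (invBE (svalP p.1.2)) !mxE /=.
- by rewrite g00E -fmorphV.
- by rewrite -raddfN.
- by rewrite -raddfN.
Qed.

Lemma jac_src g : jac (gsrc (BR_groupoid R)) g = delta_mx 0 0.
Proof.
apply/matrixP => i j; rewrite !mxE (ord1 j) andbT -(pd_cx i g).
by congr (pd _ i g); apply/funext => q; rewrite mxE cxE.
Qed.

Lemma jac_tgt g : jac (gtgt (BR_groupoid R)) g = delta_mx 4 0.
Proof.
apply/matrixP => i j; rewrite !mxE (ord1 j) andbT -(pd_cy i g).
by congr (pd _ i g); apply/funext => q; rewrite mxE cyE.
Qed.

Lemma row_full_delta n (i : 'I_n) : row_full (delta_mx i 0 : 'M[R]_(n, 1)).
Proof.
apply/row_fullP; exists (delta_mx 0 i); rewrite mul_delta_mx.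
by apply/matrixP => k l; rewrite !mxE (ord1 k) (ord1 l).
Qed.

End Groupoid.

Lemma crd_fst (R : realType) m n (M : manifold R m) (N : manifold R n)
    (q : mprod M N) k : crd q.1 0 k = crd q 0 (lshift n k).
Proof. by rewrite /= row_mxEl. Qed.

Lemma crd_snd (R : realType) m n (M : manifold R m) (N : manifold R n)
    (q : mprod M N) k : crd q.2 0 k = crd q 0 (rshift m k).
Proof. by rewrite /= row_mxEr. Qed.

Section Groupoid.
Variable R : realType.
Implicit Types (p q g h : BR R).
Notation D := (BR_groupoid R).
Notation GG := (mprod (BR R) (BR R)).

Lemma smoothv_row5 n (M : manifold R n) (x a u v y : M -> R) :
  smooth x -> smooth a -> smooth u -> smooth v -> smooth y ->
  smoothv (fun p : M => row5 (x p) (a p) (u p) (v p) (y p)).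
Proof.
move=> sx sa su sv sy j.
suff : smooth (fun p : M => nth 0 [:: x p; a p; u p; v p; y p] j).
  by congr smooth; apply/funext => p; rewrite mxE.
by elim/ord5_ind: j.
Qed.

Lemma smooth_mul_crd : smoothv (fun w : GG => row5 (cx w.1) (ca w.1 * ca w.2)
  (cu w.1 * ca w.2 + (ca w.1)^-1 * cu w.2)
  (cv w.1 * ca w.2 + (ca w.1)^-1 * cv w.2) (cy w.2)).
Proof.
have s1 k : smooth (fun w : GG => crd w.1 0 k).
  rewrite (_ : (fun w => _) = fun w => crd w 0 (lshift 5 k)).
    exact: smooth_crd.
  by apply/funext => w; rewrite crd_fst.
have s2 k : smooth (fun w : GG => crd w.2 0 k).
  rewrite (_ : (fun w => _) = fun w => crd w 0 (rshift 5 k)).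
    exact: smooth_crd.
  by apply/funext => w; rewrite crd_snd.
have [x1 a1 u1 v1] : [/\ smooth (fun w : GG => cx w.1),
  smooth (fun w : GG => ca w.1), smooth (fun w : GG => cu w.1)
  & smooth (fun w : GG => cv w.1)] by split; exact: s1.
have [y2 a2 u2 v2] : [/\ smooth (fun w : GG => cy w.2),
  smooth (fun w : GG => ca w.2), smooth (fun w : GG => cu w.2)
  & smooth (fun w : GG => cv w.2)] by split; exact: s2.
have aV : smooth (fun w : GG => (ca w.1)^-1).
  by apply: smoothV a1 => w; exact: ca_neq0.
by apply: smoothv_row5; smooth_tac.
Qed.

Lemma BR_lie_groupoid : lie_groupoid D.
Proof.
split.
- split=> // [[[x f] y] [[x' g] y'] [[x'' h] y'']] /= _ _.
  by congr (_, _, _); apply: val_inj; exact: mulmxA.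
- by split=> // -[[x g] y]; congr (_, _, _); apply: val_inj;
    rewrite /= ?mul1mx ?mulmx1.
- by split=> // -[[x g] y] /=; rewrite /gmul /= ?mulVB ?mulBV.
- split.
  + move=> j; rewrite (_ : (fun p => _) = @cx R); first exact: smooth_cx.
    by apply/funext => p; rewrite mxE cxE.
  + move=> j; rewrite (_ : (fun p => _) = @cy R); first exact: smooth_cy.
    by apply/funext => p; rewrite mxE cyE.
  + rewrite /smooth_map (funext (@crd_one R)).
    by apply: smoothv_row5; smooth_tac.
  + by rewrite /smooth_map (funext (@crd_inv R)); apply: smoothv_row5; smooth_tac.
  + move=> fg _; exists setT, (fun w : GG => row5 (cx w.1) (ca w.1 * ca w.2)
      (cu w.1 * ca w.2 + (ca w.1)^-1 * cu w.2)
      (cv w.1 * ca w.2 + (ca w.1)^-1 * cv w.2) (cy w.2)).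
    split=> //; [exact: crd_open|exact: smooth_mul_crd|].
    by move=> w _ _; rewrite crd_mul.
- by move=> g; rewrite jac_src jac_tgt !row_full_delta.
Qed.

End Groupoid.

(** * The left-invariant frame and the associated Lie bialgebroid *)

Section Frame.
Variable R : realType.
Implicit Types (p q g h : BR R).
Notation D := (BR_groupoid R).

Lemma derive_lin2 (f g : line R -> R) (a b : R) (t : line R) :
  derivable (f \o prm) (crd t) (delta_mx 0 0) ->
  derivable (g \o prm) (crd t) (delta_mx 0 0) ->
  pd (fun s => a * f s + b * g s) 0 t = a * pd f 0 t + b * pd g 0 t.
Proof.
move=> df dg.
have := deriveD (derivableZ (k := a) df) (derivableZ (k := b) dg).
by rewrite (deriveZ a df) (deriveZ b dg).
Qed.

(** The a, u, v coordinates of [gmul D g h] are linear in those of [h], so the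
velocity of a translated curve is a linear function of the velocity of the
curve. *)
Lemma frame_left_invariant i : left_invariant D (@BR_frame R i).
Proof.
split=> [g|g h _ c [[W [oW W0 sW _]] c0 vc]].
  rewrite jac_src frameE; apply/rowP => j; rewrite (ord1 j) mxE sum5.
  by elim/ord4_ind: i => /=; rewrite !mxE /=; ring.
pose x k (t : line R) := crd (c t) 0 k.
have dx k : derivable (x k \o prm) (crd (0 : line R)) (delta_mx 0 0).
  exact: smooth_in_derivable (sW k) W0.
have x' k : pd (x k) 0 (0 : line R) = BR_frame i h 0 k by rewrite -vc mxE.
have L a b k l (F : line R -> R) (z : R) :
  (forall t, F t = a * x k t + b * x l t) ->
  z = a * BR_frame i h 0 k + b * BR_frame i h 0 l -> pd F 0 (0 : line R) = z.
  move=> FE ->; rewrite -!x' -derive_lin2 //; congr (pd _ _ _).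
  by apply/funext => t; rewrite FE.
apply/rowP => j; rewrite [LHS]mxE frameE ca_mul cu_mul cv_mul.
have E k t : crd (gmul D g (c t)) 0 k = nth 0 [:: cx g; ca g * x 1 t;
   cu g * x 1 t + (ca g)^-1 * x 2 t; cv g * x 1 t + (ca g)^-1 * x 3 t; x 4 t] k.
  by rewrite crd_mul mxE.
have a0 := ca_neq0 g; have a1 := ca_neq0 h.
elim/ord5_ind: j.
- rewrite (_ : (fun t => _) = fun=> cx g).
    by rewrite pd_cst; elim/ord4_ind: i {vc x' L} => /=; rewrite mxE.
  by apply/funext => t; rewrite E.
- apply: (L (ca g) 0 1 1) => [t|]; first by rewrite E /=; ring.
  by rewrite frameE; elim/ord4_ind: i {vc x' L} => /=; rewrite !mxE /=; ring.
- apply: (L (cu g) (ca g)^-1 1 2) => [t|]; first by rewrite E /=; ring.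
  rewrite frameE; elim/ord4_ind: i {vc x' L} => /=;
    by rewrite !mxE /= ?invfM; ring.
- apply: (L (cv g) (ca g)^-1 1 3) => [t|]; first by rewrite E /=; ring.
  rewrite frameE; elim/ord4_ind: i {vc x' L} => /=;
    by rewrite !mxE /= ?invfM; ring.
- apply: (L 1 0 4 4) => [t|]; first by rewrite E /=; ring.
  by rewrite frameE; elim/ord4_ind: i {vc x' L} => /=; rewrite !mxE /=; ring.
Qed.

Lemma smooth_frame i : smoothv (@BR_frame R i).
Proof.
rewrite (funext (frameE i)); elim/ord4_ind: i; rewrite /=;
  apply: smoothv_row5; smooth_tac.
Qed.

(** A right inverse of the matrix of the frame at any unit. *)
Definition frame_inv : 'M[R]_(5, 4) := \matrix_(i, j)
  nth 0 (nth [::] [:: [:: 0; 0; 0; 0]; [:: 0; - 2; 0; 0]; [:: 0; 0; 0; 2];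
                      [:: 0; 0; 2; 0]; [:: 2^-1; 0; 0; 0]] i) j.

Lemma BR_lie_algebroid_of :
  lie_algebroid_of D (BR_algebroid R) (@BR_frame R).
Proof.
pose E y : 'M[R]_(4, 5) := \matrix_(i < 4) BR_frame i (gone D y).
have EE y i j : E y i j = nth 0 [:: row5 0 0 0 0 2; row5 0 (- 2^-1) 0 0 0;
      row5 0 0 0 2^-1 0; row5 0 0 2^-1 0 0] i 0 j.
  rewrite mxE frameE caE cuE cvE /= !mxE /= !mulr0 invr1 !mulr1 oppr0.
  by elim/ord4_ind: i.
have EK y : E y *m frame_inv = 1%:M.
  apply/matrixP => i j; rewrite mxE sum5 !EE.
  by elim/ord4_ind: i; elim/ord4_ind: j; rewrite /= !mxE /=; field.
have KE y (v : 'rV[R]_5) : v 0 0 = 0 -> v = v *m frame_inv *m E y.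
  move=> v0; apply/rowP => j; rewrite mxE sum4 !EE.
  by elim/ord5_ind: j; rewrite /= !mxE !sum5 !mxE /= v0; field.
have vs y (v : 'rV[R]_5) : v *m jac (gsrc D) (gone D y) = (v 0 0)%:M.
  apply/rowP => j; rewrite jac_src (ord1 j) mxE sum5 !mxE /=.
  by rewrite !mulr0 !addr0 mulr1.
split.
- by move=> i; split; [exact: smooth_frame|exact: frame_left_invariant].
- move=> y; split; first by apply/row_freeP; exists frame_inv; exact: EK.
  move=> v; rewrite vs; split=> [/submxP[w ->]|v0].
    rewrite mxE big1 ?raddf0 // => i _; rewrite EE.
    by elim/ord4_ind: i; rewrite /= mxE /= mulr0.
  rewrite (KE y v) ?submxMl //.
  by have := congr1 (fun A : 'M[R]_1 => A 0 0) v0; rewrite !mxE.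
- move=> y; rewrite -/(E y) jac_tgt; apply/matrixP => i j.
  rewrite (ord1 j) mxE sum5 !EE.
  by elim/ord4_ind: i; rewrite /= !mxE /=; ring.
- by move=> X Y sX sY f sf p; exact: linv_act_commutator.
Qed.

(** On functions delta vanishes because the anchor of the dual is 0, and so does
the bracket with a function of y. *)
Lemma BR_lie_bialgebroid_of : lie_bialgebroid_of D (@PiB R) (BR_algebroid R)
  (AR_algebroid R) (@BR_frame R).
Proof.
split; first exact: BR_lie_algebroid_of.
- move=> f sf g sg p; rewrite delta_fun_AR.
  rewrite [LHS](linv_actE (fun=> 0) g p) !mxE !mul0r subr0 !addr0.
  have -> : f \o gtgt D = fun q => f (cy q) by apply/funext => q /=; rewrite cyE.
  have E k : pd (fun q : BR R => f (cy q)) k p = (k == 4)%:R * pd f 0 (cy p).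
    exact: (@pd_line_crd R 5 (BR R) 4 k f p sf).
  by rewrite pbracketE !E /=; gen_pd; ring.
- by move=> X sX XL f g sf sg p; exact: delta_bracket.
Qed.

End Frame.

(** * The Poisson bivector and the graph of the multiplication *)

Section Poisson.
Variable R : realType.
Implicit Types (p : BR R) (f g h : BR R -> R).
Notation D := (BR_groupoid R).

Lemma pbracket_crd n (M : manifold R n) (P : M -> 'M[R]_n) i j (p : M) :
  pbracket P (fun q : M => crd q 0 i) (fun q : M => crd q 0 j) p = P p i j.
Proof.
rewrite /pbracket /bivapp (bigD1 i) //= (bigD1 j) //= !pd_crd !eqxx !mulr1.
rewrite !big1 ?addr0 // => k ki.
  by rewrite big1 // => l _; rewrite pd_crd (negbTE ki) mulr0 mul0r.
by rewrite pd_crd (negbTE ki) mulr0.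
Qed.

Lemma PiBE p i j : PiB p i j =
  - (ca p * cv p) * ((i == 1)%:R * (j == 2)%:R - (i == 2)%:R * (j == 1)%:R)
  + ca p * cu p * ((i == 1)%:R * (j == 3)%:R - (i == 3)%:R * (j == 1)%:R)
  - uvcoef p * ((i == 2)%:R * (j == 3)%:R - (i == 3)%:R * (j == 2)%:R).
Proof.
by rewrite -(pbracket_crd (@PiB R)) pbracketE !pd_crd !(eq_sym _ i) !(eq_sym _ j).
Qed.

Lemma PiB_poisson : poisson (@PiB R).
Proof.
split.
- move=> i j; rewrite (_ : (fun p => _) = fun p =>
    pbracket (@PiB R) (fun q => crd q 0 i) (fun q => crd q 0 j) p).
    by apply: smooth_bracket; exact: smooth_crd.
  by apply/funext => p; rewrite pbracket_crd.
- move=> p; apply/matrixP => i j; rewrite mxE [RHS]mxE !PiBE; ring.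
- by move=> f g h sf sg sh p; exact: PiB_jacobi.
Qed.

Lemma mul_PiB (alpha : 'rV[R]_5) p :
  alpha *m PiB p = row5 0
    (alpha 0 2 * (ca p * cv p) - alpha 0 3 * (ca p * cu p))
    (alpha 0 3 * uvcoef p - alpha 0 1 * (ca p * cv p))
    (alpha 0 1 * (ca p * cu p) - alpha 0 2 * uvcoef p) 0.
Proof.
apply/rowP => j; rewrite mxE sum5 !PiBE mxE.
move: (uvcoef p) (ca p) (cu p) (cv p); elim/ord5_ind: j => /=; gen_mx; intros; ring.
Qed.

Notation GGG := (mprod (mprod (BR R) (BR R)) (BR R)).

Definition graph_eq (w : GGG) : 'rV[R]_6 := \row_(j < 6) nth 0
  [:: cy w.1.1 - cx w.1.2; cx w.2 - cx w.1.1; cy w.2 - cy w.1.2;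
      ca w.2 - ca w.1.1 * ca w.1.2;
      cu w.2 - (cu w.1.1 * ca w.1.2 + (ca w.1.1)^-1 * cu w.1.2);
      cv w.2 - (cv w.1.1 * ca w.1.2 + (ca w.1.1)^-1 * cv w.1.2)] j.

Lemma graph_eqP (w : GGG) : mul_graph D w <-> graph_eq w = 0.
Proof.
case: w => [[p q] r]; rewrite /mul_graph /=; split=> [[t12 ->]|w0].
  apply/rowP => j; rewrite !mxE [w in w.1.1]/=.
  rewrite cx_mul cy_mul ca_mul cu_mul cv_mul !subrr.
  have -> : cy p - cx q = 0 by rewrite cyE cxE t12 subrr.
  by case: j => [[|[|[|[|[|[|//]]]]]] lj].
have E (j : 'I_6) := congr1 (fun v : 'rV[R]_6 => v 0 j) w0.
have := (E 0, E 1, E 2, E 3, E 4, E 5).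
rewrite !mxE /=; case; case; case; case; case.
do 6 move/subr0_eq => ?.
split; first by rewrite -cyE -cxE.
apply: (can_inj (@crdK _ _ (BR R))).
by rewrite crd_mul crdE; congr row5.
Qed.

(** The coordinates of the three factors, as abstract functions with known
derivatives; [iV] is the inverse of the coordinate a of the first factor. *)
Lemma graph_eq_coords : exists (x1 x2 x3 : 'I_5 -> GGG -> R) (iV : GGG -> R),
  [/\ forall l, [/\ smooth (x1 l), smooth (x2 l) & smooth (x3 l)],
      smooth iV,
      forall l i w, [/\ pd (x1 l) i w = (i == lshift 5 (lshift 5 l))%:R,
        pd (x2 l) i w = (i == lshift 5 (rshift 5 l))%:R
        & pd (x3 l) i w = (i == rshift (5 + 5) l)%:R],
      forall i w, pd iV i w
        = - ((i == lshift 5 (lshift 5 1))%:R / x1 1 w ^+ 2)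
    & forall j, (fun w => graph_eq w 0 j) = fun w => nth 0
  [:: x1 4 w - x2 0 w; x3 0 w - x1 0 w; x3 4 w - x2 4 w;
      x3 1 w - x1 1 w * x2 1 w;
      x3 2 w - (x1 2 w * x2 1 w + iV w * x2 2 w);
      x3 3 w - (x1 3 w * x2 1 w + iV w * x2 3 w)] j].
Proof.
have [x1 [E1 s1 d1]] : exists x1 : 'I_5 -> GGG -> R,
    [/\ forall l w, x1 l w = crd w.1.1 0 l, forall l, smooth (x1 l)
      & forall l i w, pd (x1 l) i w = (i == lshift 5 (lshift 5 l))%:R].
  exists (fun l w => crd w 0 (lshift 5 (lshift 5 l))).
  by split=> [l u|l|l i u]; rewrite -?crd_fst //; [exact: smooth_crd|exact: pd_crd].
have [x2 [E2 s2 d2]] : exists x2 : 'I_5 -> GGG -> R,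
    [/\ forall l w, x2 l w = crd w.1.2 0 l, forall l, smooth (x2 l)
      & forall l i w, pd (x2 l) i w = (i == lshift 5 (rshift 5 l))%:R].
  exists (fun l w => crd w 0 (lshift 5 (rshift 5 l))).
  by split=> [l u|l|l i u]; rewrite -?crd_fst -?crd_snd //;
    [exact: smooth_crd|exact: pd_crd].
have [x3 [E3 s3 d3]] : exists x3 : 'I_5 -> GGG -> R,
    [/\ forall l w, x3 l w = crd w.2 0 l, forall l, smooth (x3 l)
      & forall l i w, pd (x3 l) i w = (i == rshift (5 + 5) l)%:R].
  exists (fun l w => crd w 0 (rshift (5 + 5) l)).
  by split=> [l u|l|l i u]; rewrite -?crd_snd //; [exact: smooth_crd|exact: pd_crd].
have x10 u : x1 1 u != 0 by rewrite E1; exact: ca_neq0.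
have [iV [EV sV dV]] : exists iV : GGG -> R,
    [/\ forall w, iV w = (ca w.1.1)^-1, smooth iV
      & forall i w, pd iV i w = - ((i == lshift 5 (lshift 5 1))%:R / x1 1 w ^+ 2)].
  exists (fun w => (x1 1 w)^-1).
  by split=> [u| |i u]; [rewrite E1|exact: smoothV|rewrite pdV ?d1].
exists x1, x2, x3, iV; split=> // j.
by apply/funext => u; rewrite mxE !E1 !E2 !E3 !EV.
Qed.

Lemma smooth_graph_eq : smoothv graph_eq.
Proof.
have [x1 [x2 [x3 [iV [/all_and3[s1 s2 s3] sV _ _ E]]]]] := graph_eq_coords.
move=> j; rewrite E -/(smooth _).
by case: j => [[|[|[|[|[|[|//]]]]]] lj] /=; smooth_tac.
Qed.

(** Each of the six equations contains, with coefficient 1, a coordinate that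
occurs in no other one: y of the first factor, or x, y, a, u, v of the third. *)
Lemma graph_eq_full (w : GGG) : row_full (jacv graph_eq w).
Proof.
(* The directions of these coordinates, in the order of the equations. *)
pose s (k : 'I_6) : 'I_(5 + 5 + 5) := nth (lshift 5 (lshift 5 4))
  [:: lshift 5 (lshift 5 4); rshift (5 + 5) 0; rshift (5 + 5) 4;
      rshift (5 + 5) 1; rshift (5 + 5) 2; rshift (5 + 5) 3] k.
suff J j k : pd (fun w : GGG => graph_eq w 0 j) (s k) w = (k == j)%:R.
  apply/row_fullP; exists (\matrix_(k, i) (i == s k)%:R).
  apply/matrixP => k j; rewrite !mxE (bigD1 (s k)) //= !mxE eqxx mul1r J.
  by rewrite big1 ?addr0 // => i /negbTE ik; rewrite !mxE ik mul0r.
have [x1 [x2 [x3 [iV [/all_and3[s1 s2 s3] sV d dV E]]]]] := graph_eq_coords.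
have d1 l i u : pd (x1 l) i u = (i == lshift 5 (lshift 5 l))%:R.
  by have [] := d l i u.
have d2 l i u : pd (x2 l) i u = (i == lshift 5 (rshift 5 l))%:R.
  by have [] := d l i u.
have d3 l i u : pd (x3 l) i u = (i == rshift (5 + 5) l)%:R.
  by have [] := d l i u.
rewrite {}E; case: j => [[|[|[|[|[|[|//]]]]]] lj] /=;
  pd_expand; case: k => [[|[|[|[|[|[|//]]]]]] lk] /=;
  by rewrite ?(mul0r, mulr0, oppr0, addr0, subr0).
Qed.

Lemma mul_graph_submanifold : submanifold (mul_graph D).
Proof.
exists 6%N => c Cc; exists setT, graph_eq; split=> //.
- exact: crd_open.
- exact: smooth_graph_eq.
- by move=> p _; exact: graph_eqP.
- by move=> p _ _; exact: graph_eq_full.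
Qed.

End Poisson.

(** * Coisotropy of the graph *)

Section Coisotropic.
Variable R : realType.
Notation D := (BR_groupoid R).
Notation G := (BR R).
Notation GGG := (mprod (mprod G G) G).

Lemma crd_prm_BR (x a u v y : R) : 0 < a ->
  crd (prm (row5 x a u v y) : G) = row5 x a u v y.
Proof.
move=> a0; have gB : inB (mx2 a%:C%C 0 (u +i* v)%C (a%:C%C)^-1).
  by rewrite /inB !mxE /= !eqxx ltcR a0.
apply: crd_prmK; exists (x, exist (fun k => inB k) _ gB, y) => //.
by apply/rowP => j; rewrite !mxE; elim/ord5_ind: j.
Qed.

Lemma crd_eq_row5 (p : G) (x a u v y : R) : crd p = row5 x a u v y ->
  [/\ cx p = x, ca p = a, cu p = u, cv p = v & cy p = y].
Proof. by rewrite /cx /ca /cu /cv /cy => ->; rewrite !mxE. Qed.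

Lemma smoothv_row_mx n (M : manifold R n) k l (F : M -> 'rV[R]_k)
    (H : M -> 'rV[R]_l) :
  smoothv F -> smoothv H -> smoothv (fun p => row_mx (F p) (H p)).
Proof.
move=> sF sH j; rewrite (_ : (fun p : M => _) = fun p : M =>
  match fintype.split j with inl i => F p 0 i | inr i => H p 0 i end).
  by case: (fintype.split j) => i; [exact: sF|exact: sH].
by apply/funext => p; rewrite mxE.
Qed.

Lemma velocity_prod m n (M : manifold R m) (N : manifold R n)
    (c : line R -> M) (d : line R -> N) :
  velocity (fun t => (c t, d t) : mprod M N) = row_mx (velocity c) (velocity d).
Proof.
apply/rowP => j; rewrite [LHS]mxE [RHS]mxE.
rewrite (_ : (fun t => _) = fun t : line R => match fintype.split j with
  inl i => crd (c t) 0 i | inr i => crd (d t) 0 i end).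
  by case: (fintype.split j) => i; rewrite mxE.
by apply/funext => t; rewrite /= mxE.
Qed.

Lemma velocity_row5 (c : line R -> G) (x a u v y : line R -> R) :
  (forall t, crd (c t) = row5 (x t) (a t) (u t) (v t) (y t)) ->
  velocity c = row5 (pd x 0 0) (pd a 0 0) (pd u 0 0) (pd v 0 0) (pd y 0 0).
Proof.
move=> E; apply/rowP => j; rewrite !mxE.
rewrite (_ : (fun t => _) = fun t : line R => nth 0 [:: x t; a t; u t; v t; y t] j).
  by elim/ord5_ind: j.
by apply/funext => t; rewrite E mxE.
Qed.

(** A curve through [a] with velocity [da] that stays positive at all times, so
that curves in B_R can be given by global formulas. *)
Definition pos_curve (a da : R) (t : line R) : R :=
  a * (1 + da / a * t + da / a * t * (da / a * t)).

Lemma pos_curve_gt0 a da t : 0 < a -> 0 < pos_curve a da t.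
Proof.
move=> a0; rewrite mulr_gt0 //; move: (da / a * t) => s.
(* 1 + s + s ^ 2 = (s + 1 / 2) ^ 2 + 3 / 4 *)
nra.
Qed.

Lemma smooth_pos_curve a da : smooth (pos_curve a da).
Proof. by rewrite /pos_curve; smooth_tac. Qed.

Lemma pos_curve0 a da : pos_curve a da (0 : R) = a.
Proof. by rewrite /pos_curve !mulr0 !addr0 mulr1. Qed.

Lemma pd_pos_curve0 a da : a != 0 -> pd (pos_curve a da) 0 (0 : R) = da.
Proof. by move=> a0; rewrite /pos_curve; pd_expand; field. Qed.

Definition lin_curve (p : G) (dx da du dv dy : R) (t : line R) : G :=
  prm (row5 (cx p + dx * t) (pos_curve (ca p) da t)
    (cu p + du * t) (cv p + dv * t) (cy p + dy * t)).

Lemma crd_lin_curve p dx da du dv dy (t : line R) :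
  crd (lin_curve p dx da du dv dy t) = row5 (cx p + dx * t)
    (pos_curve (ca p) da t) (cu p + du * t) (cv p + dv * t) (cy p + dy * t).
Proof. by apply: crd_prm_BR; rewrite pos_curve_gt0 ?ca_gt0. Qed.

Lemma lin_curve0 p dx da du dv dy : lin_curve p dx da du dv dy (0 : R) = p.
Proof.
apply: (can_inj (@crdK _ _ G)); rewrite crd_lin_curve crdE pos_curve0.
by rewrite !mulr0 !addr0.
Qed.

(** The velocity of a curve of triples (p(t), q(t), p(t) q(t)) in terms of those
of p(t) and q(t), which share [dy] as the curves remain composable. *)
Definition graph_tangent (p q : G) (dx1 da1 du1 dv1 dy da2 du2 dv2 dy2 : R) :
    'rV[R]_(5 + 5 + 5) :=
  row_mx (row_mx (row5 dx1 da1 du1 dv1 dy) (row5 dy da2 du2 dv2 dy2))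
    (row5 dx1 (da1 * ca q + ca p * da2)
      (du1 * ca q + cu p * da2 - da1 / ca p ^+ 2 * cu q + du2 / ca p)
      (dv1 * ca q + cv p * da2 - da1 / ca p ^+ 2 * cv q + dv2 / ca p) dy2).

Lemma tangent_mul_graph (p q : G) dx1 da1 du1 dv1 dy da2 du2 dv2 dy2 :
  gtgt D p = gsrc D q ->
  tangent (mul_graph D) ((p, q), gmul D p q)
    (graph_tangent p q dx1 da1 du1 dv1 dy da2 du2 dv2 dy2).
Proof.
move=> pq; pose c1 := lin_curve p dx1 da1 du1 dv1 dy.
pose c2 := lin_curve q dy da2 du2 dv2 dy2.
have E1 := crd_lin_curve p dx1 da1 du1 dv1 dy; rewrite -/c1 in E1.
have E2 := crd_lin_curve q dy da2 du2 dv2 dy2; rewrite -/c2 in E2.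
have p0 := ca_neq0 p; have q0 := ca_neq0 q.
have sa1 := smooth_pos_curve (ca p) da1; have sa2 := smooth_pos_curve (ca q) da2.
have da10 := pd_pos_curve0 da1 p0; have da20 := pd_pos_curve0 da2 q0.
have a10 t : pos_curve (ca p) da1 t != 0.
  by rewrite gt_eqF // pos_curve_gt0 ?ca_gt0.
(* The inverse becomes a variable, whose derivative is a hypothesis. *)
have [iV [EV sV dV]] : exists iV : line R -> R,
    [/\ forall t, iV t = (pos_curve (ca p) da1 t)^-1, smooth iV
      & pd iV 0 (0 : R) = - (da1 / ca p ^+ 2)].
  exists (fun t => (pos_curve (ca p) da1 t)^-1).
  by split=> //; [exact: smoothV|rewrite pdV // da10 pos_curve0].
have E3 t : crd (gmul D (c1 t) (c2 t)) = row5 (cx p + dx1 * t)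
   (pos_curve (ca p) da1 t * pos_curve (ca q) da2 t)
   ((cu p + du1 * t) * pos_curve (ca q) da2 t + iV t * (cu q + du2 * t))
   ((cv p + dv1 * t) * pos_curve (ca q) da2 t + iV t * (cv q + dv2 * t))
   (cy q + dy2 * t).
  have [x1 a1E u1 v1 y1] := crd_eq_row5 (E1 t).
  have [x2 a2E u2 v2 y2] := crd_eq_row5 (E2 t).
  by rewrite crd_mul x1 a1E u1 v1 a2E u2 v2 y2 EV.
exists (fun t : line R => ((c1 t, c2 t), gmul D (c1 t) (c2 t)) : GGG); split.
- exists setT; split=> //; first exact: crd_open.
    apply: smoothv_row_mx; first apply: smoothv_row_mx.
    + by rewrite (funext E1); apply: smoothv_row5; smooth_tac.
    + by rewrite (funext E2); apply: smoothv_row5; smooth_tac.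
    + by rewrite (funext E3); apply: smoothv_row5; smooth_tac.
  move=> t _; split=> //.
  refine (eq_trans (esym (cyE (c1 t))) (eq_trans _ (cxE (c2 t)))).
  have [_ _ _ _ ->] := crd_eq_row5 (E1 t).
  have [-> _ _ _ _] := crd_eq_row5 (E2 t).
  by rewrite cyE cxE (pq : p.2 = q.1.1).
- by rewrite /c1 /c2 !lin_curve0.
- rewrite !velocity_prod (velocity_row5 E1) (velocity_row5 E2) (velocity_row5 E3).
  pd_expand; rewrite !pos_curve0 EV pos_curve0 /graph_tangent.
  clear -p0 q0; move: (ca p) (ca q) (cu p) (cu q) (cv p) (cv q) p0 q0.
  move=> ? ? ? ? ? ? p0 q0.
  congr (row_mx (row_mx _ _) _); congr row5; by [field; rewrite ?p0 ?q0].
Qed.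

Lemma dot_row5 (alpha : 'rV[R]_5) (x a u v y : R) :
  (alpha *m (row5 x a u v y)^T) 0 0 = alpha 0 0 * x + alpha 0 1 * a
    + alpha 0 2 * u + alpha 0 3 * v + alpha 0 4 * y.
Proof. by rewrite mxE sum5 !mxE. Qed.

(** For a conormal vector (a1, a2, a3) the equations satisfied by a1 and a2 make
the third component of its image under the bivector the velocity of the product
of two curves that realize the first two components. *)
Lemma mul_graph_coisotropic :
  coisotropic (graph_bivector (@PiB R)) (mul_graph D).
Proof.
split; first exact: mul_graph_submanifold.
move=> [[p q] r] [/= pq Er] alpha.
pose alpha1 := lsubmx (lsubmx alpha); pose alpha2 := rsubmx (lsubmx alpha).
pose alpha3 := rsubmx alpha.
have -> : alpha = row_mx (row_mx alpha1 alpha2) alpha3 by rewrite !hsubmxK.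
move: alpha1 alpha2 alpha3 => a1 a2 a3 H.
have pair dx1 da1 du1 dv1 dy da2 du2 dv2 dy2 :
    let t := graph_tangent p q dx1 da1 du1 dv1 dy da2 du2 dv2 dy2 in
    (row_mx (row_mx a1 a2) a3 *m t^T) 0 0 = 0.
  by move=> t; rewrite H ?mxE // Er; exact: tangent_mul_graph.
have E dx1 da1 du1 dv1 dy da2 du2 dv2 dy2 :
    a1 0 0 * dx1 + a1 0 1 * da1 + a1 0 2 * du1 + a1 0 3 * dv1 + a1 0 4 * dy
    + (a2 0 0 * dy + a2 0 1 * da2 + a2 0 2 * du2 + a2 0 3 * dv2 + a2 0 4 * dy2)
    + (a3 0 0 * dx1 + a3 0 1 * (da1 * ca q + ca p * da2)
       + a3 0 2 * (du1 * ca q + cu p * da2 - da1 / ca p ^+ 2 * cu q + du2 / ca p)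
       + a3 0 3 * (dv1 * ca q + cv p * da2 - da1 / ca p ^+ 2 * cv q + dv2 / ca p)
       + a3 0 4 * dy2) = 0.
  rewrite -[RHS](pair dx1 da1 du1 dv1 dy da2 du2 dv2 dy2) /graph_tangent.
  by rewrite !tr_row_mx !mul_row_col 2!mxDE !dot_row5.
(* The velocities that move one coordinate a, u or v of one factor determine the
   a, u, v components of a1 and a2 in terms of those of a3. *)
have Ea1 := E 0 1 0 0 0 0 0 0 0; have Eu1 := E 0 0 1 0 0 0 0 0 0.
have Ev1 := E 0 0 0 1 0 0 0 0 0; have Ea2 := E 0 0 0 0 0 1 0 0 0.
have Eu2 := E 0 0 0 0 0 0 1 0 0; have Ev2 := E 0 0 0 0 0 0 0 1 0.
clear H pair E.
rewrite /graph_bivector /= !mul_row_block !mulmx0 !addr0 !add0r mulmxN !mul_PiB.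
have -> : row_mx (row_mx
    (row5 0 (a1 0 2 * (ca p * cv p) - a1 0 3 * (ca p * cu p))
      (a1 0 3 * uvcoef p - a1 0 1 * (ca p * cv p))
      (a1 0 1 * (ca p * cu p) - a1 0 2 * uvcoef p) 0)
    (row5 0 (a2 0 2 * (ca q * cv q) - a2 0 3 * (ca q * cu q))
      (a2 0 3 * uvcoef q - a2 0 1 * (ca q * cv q))
      (a2 0 1 * (ca q * cu q) - a2 0 2 * uvcoef q) 0))
    (- row5 0 (a3 0 2 * (ca r * cv r) - a3 0 3 * (ca r * cu r))
      (a3 0 3 * uvcoef r - a3 0 1 * (ca r * cv r))
      (a3 0 1 * (ca r * cu r) - a3 0 2 * uvcoef r) 0)
  = graph_tangent p q 0 (a1 0 2 * (ca p * cv p) - a1 0 3 * (ca p * cu p))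
      (a1 0 3 * uvcoef p - a1 0 1 * (ca p * cv p))
      (a1 0 1 * (ca p * cu p) - a1 0 2 * uvcoef p) 0
      (a2 0 2 * (ca q * cv q) - a2 0 3 * (ca q * cu q))
      (a2 0 3 * uvcoef q - a2 0 1 * (ca q * cv q))
      (a2 0 1 * (ca q * cu q) - a2 0 2 * uvcoef q) 0; last first.
  by rewrite Er; exact: tangent_mul_graph.
congr row_mx.
have -> (x a u w y : R) : - row5 x a u w y = row5 (- x) (- a) (- u) (- w) (- y).
  by apply/rowP => j; rewrite !mxE; elim/ord5_ind: j.
have cyp : cy p = cx q by rewrite cyE cxE.
rewrite Er /uvcoef cx_mul cy_mul ca_mul cu_mul cv_mul cyp.
have p0 := ca_neq0 p; have q0 := ca_neq0 q.
move: (a1 0 0) (a1 0 1) (a1 0 2) (a1 0 3) (a1 0 4) (a2 0 0) (a2 0 1) (a2 0 2)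
  (a2 0 3) (a2 0 4) (a3 0 0) (a3 0 1) (a3 0 2) (a3 0 3) (a3 0 4)
  (ca p) (ca q) (cu p) (cu q) (cv p) (cv q) (cx p) (cx q) (cy q)
  Ea1 Eu1 Ev1 Ea2 Eu2 Ev2 p0 q0.
move=> k10 k1a k1u k1v k14 k20 k2a k2u k2v k24 k30 k3a k3u k3v k34.
move=> a b u1 u2 v1 v2 x y z Ea1 Eu1 Ev1 Ea2 Eu2 Ev2 a0 b0.
have -> : k1a = - (k3a * b - k3u * u2 / a ^+ 2 - k3v * v2 / a ^+ 2).
  by apply: subr0_eq; rewrite -[RHS]Ea1; ring.
have -> : k1u = - (k3u * b) by apply: subr0_eq; rewrite -[RHS]Eu1; ring.
have -> : k1v = - (k3v * b) by apply: subr0_eq; rewrite -[RHS]Ev1; ring.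
have -> : k2a = - (k3a * a + k3u * u1 + k3v * v1).
  by apply: subr0_eq; rewrite -[RHS]Ea2; ring.
have -> : k2u = - (k3u / a) by apply: subr0_eq; rewrite -[RHS]Eu2; ring.
have -> : k2v = - (k3v / a) by apply: subr0_eq; rewrite -[RHS]Ev2; ring.
by congr row5; field; rewrite ?a0 ?b0.
Qed.

End Coisotropic.

Theorem theorem3p3 (R : realType) :
  [/\ poisson_groupoid (BR_groupoid R) (@PiB R),
      lie_bialgebroid (BR_algebroid R) (AR_algebroid R)
    & lie_bialgebroid_of (BR_groupoid R) (@PiB R)
        (BR_algebroid R) (AR_algebroid R) (@BR_frame R)].
Proof.
split; [split|exact: BR_lie_bialgebroid|exact: BR_lie_bialgebroid_of].
- exact: BR_lie_groupoid.
- exact: PiB_poisson.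
- exact: mul_graph_coisotropic.
Qed.
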